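(* Let $R$ be a commutative ring and let $\mathcal{C}$ be a Hom-reflexive Krull-Schmidt tri-exact $R$-category. (1) If $\mathcal{C}$ is right triangulated, then it has almost split sequences on the right if and only if it admits a right Auslander-Reiten functor, or equivalently, a right Serre functor whose image lies in $\mathcal{C}[1]$. (2) If $\mathcal{C}$ is left triangulated, then it has almost split sequences on the left if and only if it admits a left Auslander-Reiten functor, or equivalently, a left Serre functor whose image lies in $\mathcal{C}[-1]$. (3) If $\mathcal{C}$ is triangulated, then it has almost split sequences if and only if it admits a right or left Auslander-Reiten equivalence, or equivalently, a right or left Serre equivalence.
   Context: $I_R$ is a minimal injective co-generator for $\mathrm{Mod}\,R$ and $D=\mathrm{Hom}_R(-,I_R)$. An $R$-module $U$ is reflexive if the canonical map $U\to D^2U$ is bijective. A tri-exact $R$-category is a full subcategory $\mathcal{C}$ (containing $0$) of a triangulated $R$-category $\mathcal{A}$ which is extension-closed: for any exact triangle $X\to Y\to Z\to X[1]$ in $\mathcal{A}$ with $X,Z\in\mathcal{C}$, also $Y\in\mathcal{C}$. Put $\mathrm{Ext}^1_{\mathcal{C}}(X,Y)=\mathrm{Hom}_{\mathcal{A}}(X,Y[1])$, functorial by composition. For $n\in\mathbb{Z}$, $\mathcal{C}[n]$ is the full subcategory of $\mathcal{A}$ of objects $M$ with $M[-n]\in\mathcal{C}$. $\mathcal{C}$ is left triangulated if for each exact triangle $X\to Y\to Z\to X[1]$ in $\mathcal{A}$ with $Y,Z\in\mathcal{C}$ also $X\in\mathcal{C}$ (equivalently $\mathcal{C}[-1]\subseteq\mathcal{C}$);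 right triangulated if for each such triangle with $X,Y\in\mathcal{C}$ also $Z\in\mathcal{C}$ (equivalently $\mathcal{C}[1]\subseteq\mathcal{C}$); triangulated if both. $\mathcal{C}$ is Hom-reflexive if $\mathrm{Hom}_{\mathcal{C}}(X,Y)$ is a reflexive $R$-module for all $X,Y\in\mathcal{C}$. An object is strongly indecomposable if its endomorphism ring is local; $\mathcal{C}$ is Krull-Schmidt if every non-zero object is a finite direct sum of strongly indecomposable objects. A morphism $f:X\to Y$ in $\mathcal{C}$ is injectively trivial if $\mathrm{Ext}^1_{\mathcal{C}}(M,f)=0$ for all $M\in\mathcal{C}$, projectively trivial if $\mathrm{Ext}^1_{\mathcal{C}}(f,M)=0$ for all $M\in\mathcal{C}$. $\overline{\mathcal{C}}$ (resp. $\underline{\mathcal{C}}$) is the quotient of $\mathcal{C}$ by the ideal of injectively (resp. projectively) trivial morphisms, with Hom-modules $\overline{\mathrm{Hom}}_{\mathcal{C}}$ (resp. $\underline{\mathrm{Hom}}_{\mathcal{C}}$). (If $\mathcal{C}$ is right triangulated then $\overline{\mathcal{C}}=\mathcal{C}$; if left triangulated then $\underline{\mathcal{C}}=\mathcal{C}$.) An object $X$ is Ext-injective (resp. Ext-projective) if $\mathrm{Ext}^1_{\mathcal{C}}(M,X)=0$ (resp. $\mathrm{Ext}^1_{\mathcal{C}}(X,M)=0$) for all $M\in\mathcal{C}$. A morphism $f:X\to Y$ is left minimal if every $h:Y\to Y$ with $hf=f$ is an automorphism; left almost split if it is not a section and every non-section $X\to M$ factors through $f$; minimal left almost split if both; the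 right versions are dual. An almost split sequence in $\mathcal{C}$ is a sequence $X\xrightarrow{f}Y\xrightarrow{g}Z$ in $\mathcal{C}$ embedding in an exact triangle $X\to Y\to Z\to X[1]$ of $\mathcal{A}$, with $f$ minimal left almost split and $g$ minimal right almost split in $\mathcal{C}$; $X$ is its starting term and $Z$ its ending term. $\mathcal{C}$ has almost split sequences on the right (resp. left) if every strongly indecomposable not Ext-projective (resp. not Ext-injective) object is the ending (resp. starting) term of an almost split sequence; it has almost split sequences if it has them on the right and on the left. A right Auslander-Reiten functor is a functor $\tau:\underline{\mathcal{C}}\to\overline{\mathcal{C}}$ with binatural $R$-linear isomorphisms $\underline{\mathrm{Hom}}_{\mathcal{C}}(X,Y)\to D\,\mathrm{Ext}^1_{\mathcal{C}}(Y,\tau X)$. A left Auslander-Reiten functor is a functor $\tau^-:\overline{\mathcal{C}}\to\underline{\mathcal{C}}$ with binatural $R$-linear isomorphisms $\overline{\mathrm{Hom}}_{\mathcal{C}}(X,Y)\to D\,\mathrm{Ext}^1_{\mathcal{C}}(\tau^-Y,X)$. A right Serre functor is a functor $\mathbb{S}:\underline{\mathcal{C}}\to\overline{\mathcal{C}}$ with binatural $R$-linear isomorphisms $\underline{\mathrm{Hom}}_{\mathcal{C}}(X,Y)\to D\,\overline{\mathrm{Hom}}_{\mathcal{C}}(Y,\mathbb{S}X)$. A left Serre functor is a functor $\mathbb{S}:\overline{\mathcal{C}}\to\underline{\mathcal{C}}$ with binatural $R$-linear isomorphisms $\overline{\mathrm{Hom}}_{\mathcal{C}}(X,Y)\to D\,\underline{\mathrm{Hom}}_{\mathcal{C}}(\mathbb{S}Y,X)$.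 Here $X,Y$ range over $\mathcal{C}$. A (right or left) Auslander-Reiten or Serre equivalence is such a functor that is an equivalence of categories. *)

(* Defs.v *)
From HB Require Import structures.
From mathcomp Require Import all_boot all_algebra.
From mathcomp Require Import boolp.

Set Implicit Arguments.
Unset Strict Implicit.
Unset Printing Implicit Defensive.

Import GRing.Theory.
Local Open Scope ring_scope.
Local Open Scope quotient_scope.

(* Commutative rings are [comPzRingType]s, so the zero ring is allowed.  The
   [choiceType] structure carried by every [lmodType] is no restriction, since
   it exists classically on every type ([boolp.gen_choiceMixin]).             *)

Section InjectiveCogenerator.
Variable R : comPzRingType.

Definition injective_module (I : lmodType R) : Prop :=
  forall (M N : lmodType R) (i : {linear M -> N}) (g : {linear M -> I}),
    injective i -> exists h : {linear N -> I}, forall x, h (i x) = g x.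

Definition cogenerator (I : lmodType R) : Prop :=
  forall (M : lmodType R) (x : M), x <> 0 -> exists f : {linear M -> I}, f x <> 0.

(* Minimality: no proper submodule of I is itself an injective cogenerator.
   Submodules are represented by injective linear maps into I.                *)
Definition minimal_injective_cogenerator (I : lmodType R) : Prop :=
  [/\ injective_module I, cogenerator I &
      forall (J : lmodType R) (i : {linear J -> I}),
        injective_module J -> cogenerator J -> injective i ->
        forall y, exists x, i x = y].

End InjectiveCogenerator.

Section Dual.
Variables (R : comPzRingType) (I : lmodType R).

Definition dual (M : lmodType R) : Type := {linear M -> I}.

Section DualModule.
Variable M : lmodType R.
Local Notation DM := (dual M).

HB.instance Definition _ := gen_eqMixin DM.
HB.instance Definition _ := gen_choiceMixin DM.

Lemma dual_ext (f g : DM) : (forall x, f x = g x) -> f = g.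
Proof.
case: f => f [[fa] [fs]]; case: g => g [[ga] [gs]] /= fg.
have {}fg : f = g by apply: funext.
case: g / fg ga gs => ga gs.
by rewrite (Prop_irrelevance fa ga) (Prop_irrelevance fs gs).
Qed.

Definition dual_zero : DM := (\0 : M -> I).
Definition dual_opp (f : DM) : DM := (\- f : M -> I).
Definition dual_add (f g : DM) : DM := (f \+ g : M -> I).
Definition dual_scale (a : R) (f : DM) : DM := (a \*: f : M -> I).

Fact dual_addA : associative dual_add.
Proof. by move=> f g h; apply: dual_ext => x /=; rewrite addrA. Qed.
Fact dual_addC : commutative dual_add.
Proof. by move=> f g; apply: dual_ext => x /=; rewrite addrC. Qed.
Fact dual_add0 : left_id dual_zero dual_add.
Proof. by move=> f; apply: dual_ext => x /=; rewrite add0r. Qed.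
Fact dual_addN : left_inverse dual_zero dual_opp dual_add.
Proof. by move=> f; apply: dual_ext => x /=; rewrite addNr. Qed.

HB.instance Definition _ :=
  GRing.isZmodule.Build DM dual_addA dual_addC dual_add0 dual_addN.

Fact dual_scaleA a b (f : DM) :
  dual_scale a (dual_scale b f) = dual_scale (a * b) f.
Proof. by apply: dual_ext => x /=; rewrite scalerA. Qed.
Fact dual_scale1 : left_id 1 dual_scale.
Proof. by move=> f; apply: dual_ext => x /=; rewrite scale1r. Qed.
Fact dual_scaleDr : right_distributive dual_scale +%R.
Proof. by move=> a f g; apply: dual_ext => x /=; rewrite scalerDr. Qed.
Fact dual_scaleDl (f : DM) : {morph dual_scale^~ f : a b / a + b}.
Proof. by move=> a b; apply: dual_ext => x /=; rewrite scalerDl. Qed.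

HB.instance Definition _ := GRing.Zmodule_isLmodule.Build R DM
  dual_scaleA dual_scale1 dual_scaleDr dual_scaleDl.

End DualModule.

Definition bidual_map (M : lmodType R) (x : M) : dual M -> I :=
  fun f => (f : {linear M -> I}) x.

Fact bidual_map_is_linear (M : lmodType R) (x : M) : linear (bidual_map x).
Proof. by []. Qed.

HB.instance Definition _ (M : lmodType R) (x : M) :=
  GRing.isLinear.Build R (dual M) I *:%R (bidual_map x) (bidual_map_is_linear x).

Definition reflexive_module (M : lmodType R) : Prop :=
  bijective (fun x : M => (bidual_map x : {linear dual M -> I})).

End Dual.

Section QuotientModule.
Variables (R : comPzRingType) (V : lmodType R) (S : {pred V}).
Hypothesis Scl : submod_closed S.

Fact submod_zmod_closed : zmod_closed S.
Proof. exact: GRing.submod_closedB Scl. Qed.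

Definition submod_zmodClosed : zmodClosed V :=
  HB.pack S (GRing.isZmodClosed.Build V S submod_zmod_closed).

Fact submod_closedZ a x : x \in S -> a *: x \in S.
Proof. by case: Scl => S0 Sl Sx; have := Sl a x 0 Sx S0; rewrite addr0. Qed.

(* The R-module V / S. *)
Definition quot_mod := Quotient.quot submod_zmodClosed.
Local Notation Q := quot_mod.

HB.instance Definition _ := GRing.Zmodule.on Q.
HB.instance Definition _ := ZmodQuotient.on Q.

Definition quot_scale (a : R) (x : Q) : Q := \pi_Q (a *: repr x).

Lemma eq_quot_pi (x y : V) : (\pi_Q x = \pi_Q y) <-> (x - y \in S).
Proof.
have -> : (x - y \in S) = (\pi_Q x == \pi_Q y).
  exact: (@Quotient.idealrBE _ submod_zmodClosed).
by split=> /eqP.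
Qed.

Lemma pi_quot_add (x y : V) : \pi_Q (x + y) = \pi_Q x + \pi_Q y :> Q.
Proof. exact: (@Quotient.pi_add _ submod_zmodClosed). Qed.

Lemma pi_quot_scale a (x : V) : quot_scale a (\pi_Q x) = \pi_Q (a *: x).
Proof.
apply/eq_quot_pi; rewrite -scalerBr submod_closedZ //.
by apply/eq_quot_pi; rewrite reprK.
Qed.

Fact quot_scaleA a b (x : Q) :
  quot_scale a (quot_scale b x) = quot_scale (a * b) x.
Proof.
by rewrite -[x]reprK (pi_quot_scale b) (pi_quot_scale a) pi_quot_scale scalerA.
Qed.
Fact quot_scale1 : left_id 1 quot_scale.
Proof. by move=> x; rewrite -[x]reprK pi_quot_scale scale1r. Qed.
Fact quot_scaleDr : right_distributive quot_scale +%R.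
Proof.
move=> a x y; rewrite -[x]reprK -[y]reprK -pi_quot_add !pi_quot_scale.
by rewrite -pi_quot_add scalerDr.
Qed.
Fact quot_scaleDl (x : Q) : {morph quot_scale^~ x : a b / a + b}.
Proof.
by move=> a b; rewrite -[x]reprK !pi_quot_scale -pi_quot_add scalerDl.
Qed.

HB.instance Definition _ := GRing.Zmodule_isLmodule.Build R Q
  quot_scaleA quot_scale1 quot_scaleDr quot_scaleDl.

End QuotientModule.

Reserved Notation "g \oc f" (at level 40, left associativity).

Record linCat (R : comPzRingType) := LinCat {
  ob :> Type;
  hom : ob -> ob -> lmodType R;
  idm : forall X, hom X X;
  comp : forall X Y Z, hom Y Z -> hom X Y -> hom X Z;
  comp1m : forall X Y (f : hom X Y), comp (idm Y) f = f;
  compm1 : forall X Y (f : hom X Y), comp f (idm X) = f;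
  compA : forall W X Y Z (h : hom Y Z) (g : hom X Y) (f : hom W X),
    comp h (comp g f) = comp (comp h g) f;
  comp_linearr : forall X Y Z (g : hom Y Z), linear (fun f : hom X Y => comp g f);
  comp_linearl : forall X Y Z (f : hom X Y), linear (fun g : hom Y Z => comp g f)
}.
Arguments idm {R l} X.
Notation "g \oc f" := (comp g f).

Section CategoryTheory.
Variables (R : comPzRingType) (C : linCat R).

Definition is_iso (X Y : C) (f : hom X Y) : Prop :=
  exists g : hom Y X, g \oc f = idm X /\ f \oc g = idm Y.

Definition is_section (X Y : C) (f : hom X Y) : Prop :=
  exists r : hom Y X, r \oc f = idm X.

Definition is_retraction (X Y : C) (f : hom X Y) : Prop :=
  exists s : hom Y X, f \oc s = idm Y.

Definition left_minimal (X Y : C) (f : hom X Y) : Prop :=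
  forall h : hom Y Y, h \oc f = f -> is_iso h.

Definition right_minimal (X Y : C) (f : hom X Y) : Prop :=
  forall h : hom X X, f \oc h = f -> is_iso h.

Definition left_almost_split (X Y : C) (f : hom X Y) : Prop :=
  ~ is_section f /\
  forall (M : C) (g : hom X M), ~ is_section g -> exists h : hom Y M, h \oc f = g.

Definition right_almost_split (X Y : C) (f : hom X Y) : Prop :=
  ~ is_retraction f /\
  forall (M : C) (g : hom M Y), ~ is_retraction g -> exists h : hom M X, f \oc h = g.

Definition minimal_left_almost_split (X Y : C) (f : hom X Y) : Prop :=
  left_minimal f /\ left_almost_split f.

Definition minimal_right_almost_split (X Y : C) (f : hom X Y) : Prop :=
  right_minimal f /\ right_almost_split f.

Definition zero_object (X : C) : Prop := idm X = 0.

(* End(X) is local: it is non-zero and its non-units are closed under addition. *)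
Definition strongly_indecomposable (X : C) : Prop :=
  idm X <> 0 /\
  forall f g : hom X X, ~ is_iso f -> ~ is_iso g -> ~ is_iso (f + g).

Definition direct_sum (n : nat) (X : C) (E : 'I_n -> C) : Prop :=
  exists (i : forall k, hom (E k) X) (p : forall k, hom X (E k)),
    [/\ forall k, p k \oc i k = idm (E k),
        forall k l, k != l -> p k \oc i l = 0 &
        \sum_(k < n) i k \oc p k = idm X].

Definition krull_schmidt : Prop :=
  forall X : C, ~ zero_object X ->
    exists (n : nat) (E : 'I_n -> C),
      direct_sum X E /\ forall k, strongly_indecomposable (E k).

Definition hom_reflexive (I : lmodType R) : Prop :=
  forall X Y : C, reflexive_module I (hom X Y).

End CategoryTheory.

(* Functors are not required to be additive or R-linear.                      *)
Record functor (R : comPzRingType) (C D : linCat R) := Functor {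
  fob :> C -> D;
  fhom : forall X Y : C, hom X Y -> hom (fob X) (fob Y);
  fhom1 : forall X, fhom (idm X) = idm (fob X);
  fhomM : forall (X Y Z : C) (g : hom Y Z) (f : hom X Y),
    fhom (g \oc f) = fhom g \oc fhom f
}.

Section Functors.
Variable R : comPzRingType.

Definition id_functor (C : linCat R) : functor C C :=
  @Functor R C C id (fun X Y f => f) (fun X => erefl) (fun X Y Z g f => erefl).

Section Composition.
Variables (C D E : linCat R) (G : functor D E) (F : functor C D).
Let ghom (X Y : C) (f : hom X Y) : hom (G (F X)) (G (F Y)) := fhom G (fhom F f).
Fact comp_fhom1 X : ghom (idm X) = idm (G (F X)).
Proof. by rewrite /ghom !fhom1. Qed.
Fact comp_fhomM (X Y Z : C) (g : hom Y Z) (f : hom X Y) :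
  ghom (g \oc f) = ghom g \oc ghom f.
Proof. by rewrite /ghom !fhomM. Qed.
Definition comp_functor : functor C E := Functor comp_fhom1 comp_fhomM.
End Composition.

Definition nat_isomorphic (C D : linCat R) (F G : functor C D) : Prop :=
  exists a : forall X : C, hom (F X) (G X),
    (forall X, is_iso (a X)) /\
    forall (X Y : C) (f : hom X Y), fhom G f \oc a X = a Y \oc fhom F f.

Definition is_equivalence (C D : linCat R) (F : functor C D) : Prop :=
  exists G : functor D C,
    nat_isomorphic (comp_functor G F) (id_functor C) /\
    nat_isomorphic (comp_functor F G) (id_functor D).

End Functors.

Record ideal (R : comPzRingType) (C : linCat R) := Ideal {
  in_ideal : forall X Y : C, hom X Y -> Prop;
  ideal0 : forall X Y : C, in_ideal (0 : hom X Y);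
  ideal_lin : forall (X Y : C) (a : R) (f g : hom X Y),
    in_ideal f -> in_ideal g -> in_ideal (a *: f + g);
  ideal_compr : forall (X Y Z : C) (g : hom Y Z) (f : hom X Y),
    in_ideal f -> in_ideal (g \oc f);
  ideal_compl : forall (X Y Z : C) (g : hom Y Z) (f : hom X Y),
    in_ideal g -> in_ideal (g \oc f)
}.

Section QuotientCategory.
Variables (R : comPzRingType) (C : linCat R) (J : ideal C).

Definition ideal_pred (X Y : C) : {pred hom X Y} := fun f => `[< in_ideal J f >].

Fact ideal_pred_closed X Y : submod_closed (@ideal_pred X Y).
Proof.
split; first by apply/asboolP/ideal0.
by move=> a f g /asboolP Jf /asboolP Jg; apply/asboolP/ideal_lin.
Qed.

Definition qhom (X Y : C) : lmodType R := quot_mod (@ideal_pred_closed X Y).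

Definition qclass (X Y : C) (f : hom X Y) : qhom X Y :=
  \pi_(quot_mod (@ideal_pred_closed X Y)) f.

Definition qrepr (X Y : C) (f : qhom X Y) : hom X Y :=
  repr (f : quot_mod (@ideal_pred_closed X Y)).

Lemma qreprK (X Y : C) : cancel (@qrepr X Y) (@qclass X Y).
Proof. exact: reprK. Qed.

Lemma eq_qclass (X Y : C) (f g : hom X Y) :
  qclass f = qclass g <-> in_ideal J (f - g).
Proof. by split=> [/eq_quot_pi/asboolP | H]; last by apply/eq_quot_pi/asboolP. Qed.

Lemma qclass_linear (X Y : C) : linear (@qclass X Y).
Proof. by move=> a f g; rewrite /qclass pi_quot_add -pi_quot_scale. Qed.

Definition qcomp (X Y Z : C) (g : qhom Y Z) (f : qhom X Y) : qhom X Z :=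
  qclass (qrepr g \oc qrepr f).

Lemma comp_subr (X Y Z : C) (g : hom Y Z) (f f' : hom X Y) :
  g \oc (f - f') = g \oc f - g \oc f'.
Proof.
by have := comp_linearr g (-1) f' f; rewrite !scaleN1r [f - _]addrC => ->; rewrite addrC.
Qed.

Lemma comp_subl (X Y Z : C) (g g' : hom Y Z) (f : hom X Y) :
  (g - g') \oc f = g \oc f - g' \oc f.
Proof.
by have := comp_linearl f (-1) g' g; rewrite !scaleN1r [g - _]addrC => ->; rewrite addrC.
Qed.

Lemma qclass_comp (X Y Z : C) (g : hom Y Z) (f : hom X Y) :
  qcomp (qclass g) (qclass f) = qclass (g \oc f).
Proof.
apply/eq_qclass.
set g' := qrepr _; set f' := qrepr _.
have Jg : in_ideal J (g' - g) by apply/eq_qclass; rewrite qreprK.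
have Jf : in_ideal J (f' - f) by apply/eq_qclass; rewrite qreprK.
have -> : g' \oc f' - g \oc f = 1 *: ((g' - g) \oc f') + g \oc (f' - f).
  by rewrite scale1r comp_subr comp_subl addrA subrK.
by apply: ideal_lin; [apply: ideal_compl | apply: ideal_compr].
Qed.

Fact qcomp1m (X Y : C) (f : qhom X Y) : qcomp (qclass (idm Y)) f = f.
Proof. by rewrite -[f]qreprK qclass_comp comp1m. Qed.
Fact qcompm1 (X Y : C) (f : qhom X Y) : qcomp f (qclass (idm X)) = f.
Proof. by rewrite -[f]qreprK qclass_comp compm1. Qed.
Fact qcompA (W X Y Z : C) (h : qhom Y Z) (g : qhom X Y) (f : qhom W X) :
  qcomp h (qcomp g f) = qcomp (qcomp h g) f.
Proof. by rewrite -[f]qreprK -[g]qreprK -[h]qreprK !qclass_comp compA. Qed.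
Fact qcomp_linearr (X Y Z : C) (g : qhom Y Z) :
  linear (fun f : qhom X Y => qcomp g f).
Proof.
move=> a f f'; rewrite -[f]qreprK -[f']qreprK -[g]qreprK -qclass_linear.
by rewrite !qclass_comp comp_linearr qclass_linear.
Qed.
Fact qcomp_linearl (X Y Z : C) (f : qhom X Y) :
  linear (fun g : qhom Y Z => qcomp g f).
Proof.
move=> a g g'; rewrite -[f]qreprK -[g]qreprK -[g']qreprK -qclass_linear.
by rewrite !qclass_comp comp_linearl qclass_linear.
Qed.

Definition quotient_cat : linCat R :=
  @LinCat R C qhom (fun X => qclass (idm X)) qcomp
    qcomp1m qcompm1 qcompA qcomp_linearr qcomp_linearl.

End QuotientCategory.

(* The shift functor is an R-linear autoequivalence with chosen quasi-inverse;
   an automorphism is a special case, and no equalities of objects are needed. *)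
Record triCat (R : comPzRingType) := TriCat {
  tcat :> linCat R;
  zob : tcat;
  zobP : zero_object zob;
  biproducts : forall X Y : tcat,
    exists (S : tcat) (i1 : hom X S) (i2 : hom Y S) (p1 : hom S X) (p2 : hom S Y),
      [/\ p1 \oc i1 = idm X, p2 \oc i2 = idm Y, p1 \oc i2 = 0, p2 \oc i1 = 0 &
          i1 \oc p1 + i2 \oc p2 = idm S];
  shift : functor tcat tcat;
  unshift : functor tcat tcat;
  shift_linear : forall X Y : tcat, linear (@fhom _ _ _ shift X Y);
  shiftK : nat_isomorphic (comp_functor unshift shift) (id_functor tcat);
  unshiftK : nat_isomorphic (comp_functor shift unshift) (id_functor tcat);
  exact_triangle : forall X Y Z : tcat, hom X Y -> hom Y Z -> hom Z (shift X) -> Prop;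
  exact_iso : forall (X Y Z X' Y' Z' : tcat)
      (f : hom X Y) (g : hom Y Z) (h : hom Z (shift X))
      (f' : hom X' Y') (g' : hom Y' Z') (h' : hom Z' (shift X'))
      (a : hom X X') (b : hom Y Y') (c : hom Z Z'),
    is_iso a -> is_iso b -> is_iso c ->
    b \oc f = f' \oc a -> c \oc g = g' \oc b -> fhom shift a \oc h = h' \oc c ->
    exact_triangle f g h -> exact_triangle f' g' h';
  exact_id : forall X : tcat,
    exact_triangle (idm X) (0 : hom X zob) (0 : hom zob (shift X));
  exact_cone : forall (X Y : tcat) (f : hom X Y),
    exists (Z : tcat) (g : hom Y Z) (h : hom Z (shift X)), exact_triangle f g h;
  exact_rot : forall (X Y Z : tcat)
      (f : hom X Y) (g : hom Y Z) (h : hom Z (shift X)),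
    exact_triangle f g h <-> exact_triangle g h (- fhom shift f);
  exact_fill : forall (X Y Z X' Y' Z' : tcat)
      (f : hom X Y) (g : hom Y Z) (h : hom Z (shift X))
      (f' : hom X' Y') (g' : hom Y' Z') (h' : hom Z' (shift X'))
      (a : hom X X') (b : hom Y Y'),
    exact_triangle f g h -> exact_triangle f' g' h' -> b \oc f = f' \oc a ->
    exists c : hom Z Z', c \oc g = g' \oc b /\ fhom shift a \oc h = h' \oc c;
  exact_octahedron : forall (X Y Z X' Y' Z' : tcat) (f : hom X Y) (g : hom Y Z)
      (u1 : hom Y Z') (v1 : hom Z' (shift X))
      (u2 : hom Z X') (v2 : hom X' (shift Y))
      (u3 : hom Z Y') (v3 : hom Y' (shift X)),
    exact_triangle f u1 v1 -> exact_triangle g u2 v2 -> exact_triangle (g \oc f) u3 v3 ->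
    exists (a : hom Z' Y') (b : hom Y' X'),
      [/\ exact_triangle a b (fhom shift u1 \oc v2),
          a \oc u1 = u3 \oc g, v3 \oc a = v1,
          b \oc u3 = u2 & fhom shift f \oc v3 = v2 \oc b]
}.

(* [nshift n X] is X[n]. *)
Definition nshift (R : comPzRingType) (A : triCat R) (n : int) (X : A) : A :=
  match n with
  | Posz k => iter k (fob (shift A)) X
  | Negz k => iter k.+1 (fob (unshift A)) X
  end.

Record triExactCat (R : comPzRingType) (A : triCat R) := TriExactCat {
  in_cat : A -> Prop;
  in_cat0 : in_cat (zob A);
  in_cat_ext : forall (X Y Z : A) (f : hom X Y) (g : hom Y Z) (h : hom Z (shift A X)),
    exact_triangle f g h -> in_cat X -> in_cat Z -> in_cat Y
}.

Definition full_subcat (R : comPzRingType) (C : linCat R) (P : C -> Prop) : linCat R :=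
  @LinCat R {X : C | P X} (fun X Y => hom (sval X) (sval Y))
    (fun X => idm (sval X)) (fun X Y Z g f => g \oc f)
    (fun X Y f => comp1m f) (fun X Y f => compm1 f)
    (fun W X Y Z h g f => compA h g f)
    (fun X Y Z g => @comp_linearr R C (sval X) (sval Y) (sval Z) g)
    (fun X Y Z f => @comp_linearl R C (sval X) (sval Y) (sval Z) f).

Definition tecat (R : comPzRingType) (A : triCat R) (C : triExactCat A) : linCat R :=
  full_subcat (@in_cat R A C).
Coercion tecat : triExactCat >-> linCat.

Section TriExact.
Variables (R : comPzRingType) (A : triCat R) (C : triExactCat A).

Definition shift_subcat (n : int) (M : A) : Prop := in_cat C (nshift (- n) M).

Definition left_triangulated : Prop :=
  forall (X Y Z : A) (f : hom X Y) (g : hom Y Z) (h : hom Z (shift A X)),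
    exact_triangle f g h -> in_cat C Y -> in_cat C Z -> in_cat C X.

Definition right_triangulated : Prop :=
  forall (X Y Z : A) (f : hom X Y) (g : hom Y Z) (h : hom Z (shift A X)),
    exact_triangle f g h -> in_cat C X -> in_cat C Y -> in_cat C Z.

Definition triangulated : Prop := left_triangulated /\ right_triangulated.

Definition Ext1 (X Y : C) : lmodType R := hom (sval X) (shift A (sval Y)).

Definition ext_post (M X Y : C) (f : hom X Y) (e : Ext1 M X) : Ext1 M Y :=
  @fhom _ _ _ (shift A) (sval X) (sval Y) f \oc e.

Definition ext_pre (X Y M : C) (e : Ext1 Y M) (f : hom X Y) : Ext1 X M :=
  @comp _ A (sval X) (sval Y) _ e f.

Definition inj_trivial (X Y : C) (f : hom X Y) : Prop :=
  forall (M : C) (e : Ext1 M X), ext_post f e = 0.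

Definition proj_trivial (X Y : C) (f : hom X Y) : Prop :=
  forall (M : C) (e : Ext1 Y M), ext_pre e f = 0.

Definition ext_injective (X : C) : Prop := forall (M : C) (e : Ext1 M X), e = 0.

Definition ext_projective (X : C) : Prop := forall (M : C) (e : Ext1 X M), e = 0.

Lemma ext_post_lin (M X Y : C) a (f g : hom X Y) (e : Ext1 M X) :
  ext_post (a *: f + g) e = a *: ext_post f e + ext_post g e.
Proof. by rewrite /ext_post shift_linear comp_linearl. Qed.

Lemma ext_post_comp (M X Y Z : C) (g : hom Y Z) (f : hom X Y) (e : Ext1 M X) :
  ext_post (g \oc f) e = ext_post g (ext_post f e).
Proof. by rewrite /ext_post fhomM compA. Qed.

Lemma ext_post0r (M X Y : C) (f : hom X Y) : ext_post f (0 : Ext1 M X) = 0.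
Proof.
rewrite /ext_post -[X in _ \oc X](subrr 0) comp_subr; exact: subrr.
Qed.

Lemma ext_post0l (M X Y : C) (e : Ext1 M X) : ext_post (0 : hom X Y) e = 0.
Proof.
by have := @ext_post_lin M X Y (-1) 0 0 e; rewrite scaler0 addr0 scaleN1r addNr.
Qed.

Lemma ext_pre_lin (X Y M : C) a (f g : hom X Y) (e : Ext1 Y M) :
  ext_pre e (a *: f + g) = a *: ext_pre e f + ext_pre e g.
Proof. exact: comp_linearr. Qed.

Lemma ext_pre_comp (X Y Z M : C) (g : hom Y Z) (f : hom X Y) (e : Ext1 Z M) :
  ext_pre e (g \oc f) = ext_pre (ext_pre e g) f.
Proof. exact: compA. Qed.

Lemma ext_pre0l (X Y M : C) (f : hom X Y) : ext_pre (0 : Ext1 Y M) f = 0.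
Proof.
rewrite /ext_pre -[X in X \oc _](subrr 0) comp_subl; exact: subrr.
Qed.

Lemma ext_pre0r (X Y M : C) (e : Ext1 Y M) : ext_pre e (0 : hom X Y) = 0.
Proof.
by have := @ext_pre_lin X Y M (-1) 0 0 e; rewrite scaler0 addr0 scaleN1r addNr.
Qed.

Fact inj_trivial0 (X Y : C) : inj_trivial (0 : hom X Y).
Proof. by move=> M e; apply: ext_post0l. Qed.
Fact inj_trivial_lin (X Y : C) (a : R) (f g : hom X Y) :
  inj_trivial f -> inj_trivial g -> inj_trivial (a *: f + g).
Proof. by move=> If Ig M e; rewrite ext_post_lin If Ig scaler0 addr0. Qed.
Fact inj_trivial_compr (X Y Z : C) (g : hom Y Z) (f : hom X Y) :
  inj_trivial f -> inj_trivial (g \oc f).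
Proof. by move=> If M e; rewrite ext_post_comp If ext_post0r. Qed.
Fact inj_trivial_compl (X Y Z : C) (g : hom Y Z) (f : hom X Y) :
  inj_trivial g -> inj_trivial (g \oc f).
Proof. by move=> Ig M e; rewrite ext_post_comp Ig. Qed.

Definition inj_trivial_ideal : ideal C :=
  Ideal inj_trivial0 inj_trivial_lin inj_trivial_compr inj_trivial_compl.

Fact proj_trivial0 (X Y : C) : proj_trivial (0 : hom X Y).
Proof. by move=> M e; apply: ext_pre0r. Qed.
Fact proj_trivial_lin (X Y : C) (a : R) (f g : hom X Y) :
  proj_trivial f -> proj_trivial g -> proj_trivial (a *: f + g).
Proof. by move=> Pf Pg M e; rewrite ext_pre_lin Pf Pg scaler0 addr0. Qed.
Fact proj_trivial_compr (X Y Z : C) (g : hom Y Z) (f : hom X Y) :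
  proj_trivial f -> proj_trivial (g \oc f).
Proof. by move=> Pf M e; rewrite ext_pre_comp Pf. Qed.
Fact proj_trivial_compl (X Y Z : C) (g : hom Y Z) (f : hom X Y) :
  proj_trivial g -> proj_trivial (g \oc f).
Proof. by move=> Pg M e; rewrite ext_pre_comp Pg ext_pre0l. Qed.

Definition proj_trivial_ideal : ideal C :=
  Ideal proj_trivial0 proj_trivial_lin proj_trivial_compr proj_trivial_compl.

Definition over_cat : linCat R := quotient_cat inj_trivial_ideal.
Definition under_cat : linCat R := quotient_cat proj_trivial_ideal.

Definition over_class (X Y : C) (f : hom X Y) : @hom R over_cat X Y :=
  qclass inj_trivial_ideal f.
Definition under_class (X Y : C) (f : hom X Y) : @hom R under_cat X Y :=
  qclass proj_trivial_ideal f.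

(* Ext^1(M,-) factors through [over_cat] and Ext^1(-,M) through [under_cat];
   see [over_extE] and [under_extE].                                          *)
Definition over_ext (M X Y : C) (f : @hom R over_cat X Y) (e : Ext1 M X) : Ext1 M Y :=
  ext_post (qrepr f) e.
Definition under_ext (X Y M : C) (e : Ext1 Y M) (f : @hom R under_cat X Y) : Ext1 X M :=
  ext_pre e (qrepr f).

Lemma over_extE (M X Y : C) (f : hom X Y) (e : Ext1 M X) :
  over_ext (over_class f) e = ext_post f e.
Proof.
have /eq_qclass /(_ M e) : qclass inj_trivial_ideal (qrepr (over_class f)) =
                           qclass inj_trivial_ideal f by rewrite qreprK.
rewrite -[_ - f]addrC -scaleN1r ext_post_lin scaleN1r addrC.
by move/eqP; rewrite subr_eq0 => /eqP.
Qed.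

Lemma under_extE (X Y M : C) (f : hom X Y) (e : Ext1 Y M) :
  under_ext e (under_class f) = ext_pre e f.
Proof.
have /eq_qclass /(_ M e) : qclass proj_trivial_ideal (qrepr (under_class f)) =
                           qclass proj_trivial_ideal f by rewrite qreprK.
rewrite -[_ - f]addrC -scaleN1r ext_pre_lin scaleN1r addrC.
by move/eqP; rewrite subr_eq0 => /eqP.
Qed.

Definition almost_split_sequence (X Y Z : C) (f : hom X Y) (g : hom Y Z) : Prop :=
  [/\ exists h : hom (sval Z) (shift A (sval X)),
        @exact_triangle R A (sval X) (sval Y) (sval Z) f g h,
      minimal_left_almost_split f & minimal_right_almost_split g].

Definition has_almost_split_sequences_right : Prop :=
  forall Z : C, strongly_indecomposable Z -> ~ ext_projective Z ->
    exists (X Y : C) (f : hom X Y) (g : hom Y Z), almost_split_sequence f g.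

Definition has_almost_split_sequences_left : Prop :=
  forall X : C, strongly_indecomposable X -> ~ ext_injective X ->
    exists (Y Z : C) (f : hom X Y) (g : hom Y Z), almost_split_sequence f g.

Definition has_almost_split_sequences : Prop :=
  has_almost_split_sequences_right /\ has_almost_split_sequences_left.

Variable I : lmodType R.

(* Binaturality is stated jointly in both variables and for morphisms u, v of C;
   as the quotient functors are full, every morphism of [under_cat] and of
   [over_cat] is the class of one of these.                                   *)

Definition right_AR_functor (tau : functor under_cat over_cat) : Prop :=
  exists phi : forall X Y : C,
      {linear @hom R under_cat X Y -> dual I (Ext1 Y (tau X))},
    (forall X Y, bijective (phi X Y)) /\
    forall (X X' Y Y' : C) (u : hom X' X) (v : hom Y Y')
        (f : @hom R under_cat X Y) (e : Ext1 Y' (tau X')),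
      phi X' Y' (under_class v \oc f \oc under_class u) e =
      phi X Y f (ext_pre (over_ext (fhom tau (under_class u)) e) v).

Definition left_AR_functor (tau : functor over_cat under_cat) : Prop :=
  exists phi : forall X Y : C,
      {linear @hom R over_cat X Y -> dual I (Ext1 (tau Y) X)},
    (forall X Y, bijective (phi X Y)) /\
    forall (X X' Y Y' : C) (u : hom X' X) (v : hom Y Y')
        (f : @hom R over_cat X Y) (e : Ext1 (tau Y') X'),
      phi X' Y' (over_class v \oc f \oc over_class u) e =
      phi X Y f (ext_post u (under_ext e (fhom tau (over_class v)))).

Definition right_Serre_functor (S : functor under_cat over_cat) : Prop :=
  exists phi : forall X Y : C,
      {linear @hom R under_cat X Y -> dual I (@hom R over_cat Y (S X))},
    (forall X Y, bijective (phi X Y)) /\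
    forall (X X' Y Y' : C) (u : hom X' X) (v : hom Y Y')
        (f : @hom R under_cat X Y) (e : @hom R over_cat Y' (S X')),
      phi X' Y' (under_class v \oc f \oc under_class u) e =
      phi X Y f (fhom S (under_class u) \oc e \oc over_class v).

Definition left_Serre_functor (S : functor over_cat under_cat) : Prop :=
  exists phi : forall X Y : C,
      {linear @hom R over_cat X Y -> dual I (@hom R under_cat (S Y) X)},
    (forall X Y, bijective (phi X Y)) /\
    forall (X X' Y Y' : C) (u : hom X' X) (v : hom Y Y')
        (f : @hom R over_cat X Y) (e : @hom R under_cat (S Y') X'),
      phi X' Y' (over_class v \oc f \oc over_class u) e =
      phi X Y f (under_class u \oc e \oc fhom S (over_class v)).

End TriExact.

(* Main.v *)
(* Write E(X, Y) = Ext^1(X, Y) and call a linear form th on E(Z, T) representing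
   if f |-> th(- f) identifies Hom(Z, Y), modulo projectively trivial morphisms,
   with D E(Y, T) for every Y.  A right Auslander-Reiten functor amounts to a
   representing form on some E(Z, tau Z) for every Z: when C[1] is contained in
   C, replacing Y by Y[1] in the pairing Hom(Z, Y) x E(Y, T) -> I and using
   reflexivity shows that t |-> th(t -) also identifies Hom(Y, T) with
   D E(Z, Y), and this makes tau functorial and fully faithful.

   If T -> Y -> Z is almost split with class e, any form th with th(e) <> 0 is
   representing: every non-zero element of E(Z, M) can be pushed forward to e,
   every non-zero element of E(Y, T) can be pulled back to e, so the pairing is
   non-degenerate on both sides, and reflexivity of E(Y, T) makes it perfect.
   Krull-Schmidt decompositions give the general case.  Conversely, if Z is
   strongly indecomposable, not Ext-projective, and th represents, reflexivity
   provides e in E(Z, T) with th(e) <> 0 and th(e f) = 0 for all non-isomorphisms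
   f of Z; the triangle of e is then almost split.

   The left-hand statements are the same statements in the opposite category.  *)

From HB Require Import structures.
From mathcomp Require Import all_boot all_algebra.
From mathcomp Require Import boolp.
Require Import Defs.

Set Implicit Arguments.
Unset Strict Implicit.
Unset Printing Implicit Defensive.
Import GRing.Theory.

Reserved Notation "f \ac e" (at level 40, left associativity).
Reserved Notation "e \pc f" (at level 40, left associativity).

(** [bijective] asks for an inverse function, which is chosen classically through [cid]. *)
Lemma inj_surj_bijective (T U : Type) (f : T -> U) :
  injective f -> (forall y, exists x, f x = y) -> bijective f.
Proof.
move=> fI /(_ _)/cid fS; exists (fun y => sval (fS y)) => [x|y].
  by apply: fI; apply: svalP (fS (f x)).
exact: svalP (fS y).
Qed.

(** * Modules *)

Section Modules.
Local Open Scope ring_scope.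
Variable R : comPzRingType.

(** Lets the library lemmas on linear maps apply to plain functions with a proof of linearity, such
    as composition in one variable. *)
Definition mk_linear (U V : lmodType R) (f : U -> V) (lf : linear f) :
    {linear U -> V} :=
  HB.pack f (GRing.isLinear.Build R U V *:%R f lf).

Variable I : lmodType R.
Hypothesis cogI : cogenerator I.

(** In the quotient of [V] by [P] the class of [x] is non-zero, so the cogenerator detects it. *)
Lemma separate_submodule (V : lmodType R) (P : V -> Prop) (x : V) :
    P 0 -> (forall a u v, P u -> P v -> P (a *: u + v)) -> ~ P x ->
  exists F : {linear V -> I}, F x <> 0 /\ forall y, P y -> F y = 0.
Proof.
move=> P0 Pl Px; pose S : {pred V} := fun y => `[< P y >].
have Scl : submod_closed S.
  split; first exact/asboolP.
  by move=> a u v /asboolP Pu /asboolP Pv; apply/asboolP/Pl.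
pose p (y : V) : quot_mod Scl := (\pi_(quot_mod Scl) y)%qT.
have pl : linear p by move=> a u v; rewrite /p pi_quot_add -pi_quot_scale.
have pE y : p y = 0 <-> P y.
  have /= <- := linear0 (mk_linear pl).
  by split=> [/eq_quot_pi|Py]; rewrite ?subr0; [move/asboolP |
    apply/eq_quot_pi; rewrite subr0; apply/asboolP].
have [|F Fx] := @cogI (quot_mod Scl) (p x); first by move/pE.
have Fl : linear (F \o p) by move=> a u v /=; rewrite pl linearP.
by exists (mk_linear Fl); split=> // y /pE /= ->; rewrite linear0.
Qed.

(** A form on the dual of [U] that vanishes on [P] but not at [x] is, by reflexivity, evaluation at
    some [e]. *)
Lemma reflexive_separate (U : lmodType R) (P : dual I U -> Prop) (x : dual I U) :
    reflexive_module I U -> P 0 ->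
    (forall a u v, P u -> P v -> P (a *: u + v)) -> ~ P x ->
  exists e : U, (x : {linear U -> I}) e <> 0 /\
    forall y, P y -> (y : {linear U -> I}) e = 0.
Proof.
move=> [g _ gK] P0 Pl Px; have [F [Fx FP]] := separate_submodule P0 Pl Px.
have E (y : dual I U) : (y : {linear U -> I}) (g F) = F y.
  by have /(congr1 (fun G : {linear dual I U -> I} => G y)) := gK F.
by exists (g F); rewrite E; split=> // y /FP; rewrite E.
Qed.

(** Transposing the inverse of [f] twice turns a form on the dual of [V] into one on the dual of
    [U]; that one is evaluation at a point, which [f] carries to [V]. *)
Lemma reflexive_iso (U V : lmodType R) (f : {linear U -> V}) :
  bijective f -> reflexive_module I U -> reflexive_module I V.
Proof.
move=> [g fK gK] [b bK Kb].
have gl : linear g by move=> a x y; apply: (can_inj fK); rewrite linearP !gK.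
pose tf : dual I V -> dual I U :=
  fun y => ((y : {linear V -> I}) \o f : U -> I).
pose tg : dual I U -> dual I V :=
  fun y => ((y : {linear U -> I}) \o mk_linear gl : V -> I).
have tgl : linear tg by move=> a u v; apply: dual_ext.
pose c (F : {linear dual I V -> I}) : V :=
  f (b (F \o mk_linear tgl : dual I U -> I)).
exists c => [x|F].
  rewrite /c -[RHS]gK; congr (f _); rewrite -[RHS]bK; congr (b _).
  by apply: dual_ext => y /=.
apply: dual_ext => y; rewrite /c /= /bidual_map.
have /(congr1 (fun H : {linear dual I U -> I} => H (tf y))) /= :=
  Kb (F \o mk_linear tgl : dual I U -> I).
rewrite /bidual_map /= => ->; congr (F _).
by apply: dual_ext => z /=; rewrite gK.
Qed.

End Modules.

(** * Categories with an Ext bimodule *)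

(* What is used of a tri-exact category and its bimodule Ext^1, in a form that is
   symmetric under passing to the opposite category.  Unlike opposites of
   triangulated categories, opposites of such structures need no choice of an
   inverse shift.                                                             *)
Record extCat (R : comPzRingType) := ExtCat {
  ecat :> linCat R;
  ext : ecat -> ecat -> lmodType R;
  post : forall M X Y : ecat, hom X Y -> ext M X -> ext M Y;
  pre : forall X Y M : ecat, ext Y M -> hom X Y -> ext X M;
  conflation : forall X Y Z : ecat, hom X Y -> hom Y Z -> ext Z X -> Prop;
  post1 : forall M X (e : ext M X), post (idm X) e = e;
  pre1 : forall X M (e : ext X M), pre e (idm X) = e;
  postA : forall M X Y Z (g : hom Y Z) (f : hom X Y) (e : ext M X),
    post (g \oc f) e = post g (post f e);
  preA : forall X Y Z M (g : hom Y Z) (f : hom X Y) (e : ext Z M),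
    pre e (g \oc f) = pre (pre e g) f;
  post_pre : forall W X Y Z (f : hom Y Z) (e : ext X Y) (g : hom W X),
    pre (post f e) g = post f (pre e g);
  post_linear : forall M X Y (f : hom X Y), linear (fun e : ext M X => post f e);
  post_linearl : forall M X Y (e : ext M X), linear (fun f : hom X Y => post f e);
  pre_linear : forall X Y M (f : hom X Y), linear (fun e : ext Y M => pre e f);
  pre_linearr : forall X Y M (e : ext Y M), linear (fun f : hom X Y => pre e f);
  ezero : ecat;
  ezeroP : zero_object ezero;
  realize : forall Z X (e : ext Z X),
    exists (Y : ecat) (f : hom X Y) (g : hom Y Z), conflation f g e;
  conf_comp : forall X Y Z (f : hom X Y) (g : hom Y Z) (e : ext Z X),
    conflation f g e -> (g \oc f = 0)%R;
  conf_pre : forall X Y Z (f : hom X Y) (g : hom Y Z) (e : ext Z X),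
    conflation f g e -> (pre e g = 0)%R;
  conf_post : forall X Y Z (f : hom X Y) (g : hom Y Z) (e : ext Z X),
    conflation f g e -> (post f e = 0)%R;
  conf_lift : forall X Y Z (f : hom X Y) (g : hom Y Z) (e : ext Z X),
    conflation f g e ->
    forall M (h : hom M Z), (pre e h = 0)%R -> exists k : hom M Y, g \oc k = h;
  conf_extend : forall X Y Z (f : hom X Y) (g : hom Y Z) (e : ext Z X),
    conflation f g e ->
    forall M (h : hom X M), (post h e = 0)%R -> exists k : hom Y M, k \oc f = h;
  conf_ker : forall X Y Z (f : hom X Y) (g : hom Y Z) (e : ext Z X),
    conflation f g e ->
    forall M (h : hom M Y), (g \oc h = 0)%R -> exists k : hom M X, f \oc k = h;
  conf_coker : forall X Y Z (f : hom X Y) (g : hom Y Z) (e : ext Z X),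
    conflation f g e ->
    forall M (h : hom Y M), (h \oc f = 0)%R -> exists k : hom Z M, k \oc g = h;
  conf_fillr : forall X Y Z (f : hom X Y) (g : hom Y Z) (e : ext Z X)
      X' Y' Z' (f' : hom X' Y') (g' : hom Y' Z') (e' : ext Z' X')
      (a : hom X X') (b : hom Y Y'),
    conflation f g e -> conflation f' g' e' -> b \oc f = f' \oc a ->
    exists c : hom Z Z', c \oc g = g' \oc b /\ post a e = pre e' c;
  conf_filll : forall X Y Z (f : hom X Y) (g : hom Y Z) (e : ext Z X)
      X' Y' Z' (f' : hom X' Y') (g' : hom Y' Z') (e' : ext Z' X')
      (b : hom Y Y') (c : hom Z Z'),
    conflation f g e -> conflation f' g' e' -> c \oc g = g' \oc b ->
    exists a : hom X X', b \oc f = f' \oc a /\ post a e = pre e' c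
}.

Notation "f \ac e" := (post f e).
Notation "e \pc f" := (pre e f).

(** * Opposite categories *)

Section Opposite.
Variable R : comPzRingType.

Definition op_cat (C : linCat R) : linCat R :=
  @LinCat R C (fun X Y => hom Y X) (fun X => idm X) (fun X Y Z g f => f \oc g)
    (fun X Y f => compm1 f) (fun X Y f => comp1m f)
    (fun W X Y Z h g f => esym (compA f g h))
    (fun X Y Z g => comp_linearl (Z := X) g) (fun X Y Z f => comp_linearr (X := Z) f).

(** Each axiom is supplied by its mirror image in [C]: lifting by extension, kernels by cokernels,
    right filling by left filling. *)
Definition op (C : extCat R) : extCat R :=
  @ExtCat R (op_cat C) (fun X Y => @ext R C Y X)
    (fun M X Y f e => e \pc f) (fun X Y M e f => f \ac e)
    (fun X Y Z f g e => @conflation R C Z Y X g f e)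
    (fun M X e => pre1 e) (fun X M e => post1 e)
    (fun M X Y Z g f e => preA f g e) (fun X Y Z M g f e => postA f g e)
    (fun W X Y Z f e g => esym (post_pre g e f))
    (fun M X Y f => pre_linear (M := M) f) (fun M X Y e => pre_linearr (X := Y) e)
    (fun X Y M f => post_linear (M := M) f) (fun X Y M e => post_linearl (Y := X) e)
    (ezero C) (ezeroP C)
    (fun Z X e => let: ex_intro Y (ex_intro f (ex_intro g H)) := realize e in
       ex_intro _ Y (ex_intro _ g (ex_intro _ f H)))
    (fun X Y Z f g e H => conf_comp H)
    (fun X Y Z f g e H => conf_post H)
    (fun X Y Z f g e H => conf_pre H)
    (fun X Y Z f g e H => @conf_extend R C _ _ _ _ _ _ H)
    (fun X Y Z f g e H => @conf_lift R C _ _ _ _ _ _ H)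
    (fun X Y Z f g e H => @conf_coker R C _ _ _ _ _ _ H)
    (fun X Y Z f g e H => @conf_ker R C _ _ _ _ _ _ H)
    (fun X Y Z f g e X' Y' Z' f' g' e' a b H H' E =>
       let: ex_intro c (conj E1 E2) := conf_filll H' H (esym E) in
       ex_intro _ c (conj (esym E1) (esym E2)))
    (fun X Y Z f g e X' Y' Z' f' g' e' a b H H' E =>
       let: ex_intro c (conj E1 E2) := conf_fillr H' H (esym E) in
       ex_intro _ c (conj (esym E1) (esym E2))).

Lemma op_iso (C : linCat R) (X Y : C) (f : hom X Y) :
  @is_iso R (op_cat C) Y X f <-> is_iso f.
Proof. by split=> -[g [gf fg]]; exists g. Qed.

Lemma op_strongly_indecomposable (C : linCat R) (X : C) :
  @strongly_indecomposable R (op_cat C) X <-> strongly_indecomposable X.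
Proof.
split=> -[X0 Xl]; split=> // f g If Ig.
  by move/op_iso; apply: Xl => /op_iso.
by move/op_iso; apply: Xl => Ih; [apply: If | apply: Ig]; apply/op_iso.
Qed.

Lemma op_krull_schmidt (C : linCat R) : krull_schmidt C -> krull_schmidt (op_cat C).
Proof.
move=> KS X /KS[n [E [[i [p [pi pi0 ip]]] El]]].
exists n, E; split=> [|k]; last exact/op_strongly_indecomposable.
by exists p, i; split=> // k l kl; apply: pi0; rewrite eq_sym.
Qed.

End Opposite.

(** * Linear categories and local endomorphism rings *)

Section LinearCategory.
Local Open Scope ring_scope.
Variables (R : comPzRingType) (C : linCat R).

Lemma comp0m (X Y Z : C) (f : hom X Y) : (0 : hom Y Z) \oc f = 0.
Proof. exact: linear0 (mk_linear (comp_linearl f)). Qed.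

Lemma compm0 (X Y Z : C) (g : hom Y Z) : g \oc (0 : hom X Y) = 0.
Proof. exact: linear0 (mk_linear (comp_linearr g)). Qed.

Lemma compNm (X Y Z : C) (g : hom Y Z) (f : hom X Y) : (- g) \oc f = - (g \oc f).
Proof. exact: linearN (mk_linear (comp_linearl f)) g. Qed.

Lemma compmN (X Y Z : C) (g : hom Y Z) (f : hom X Y) : g \oc (- f) = - (g \oc f).
Proof. exact: linearN (mk_linear (comp_linearr g)) f. Qed.

Lemma compmD (X Y Z : C) (g : hom Y Z) (f f' : hom X Y) :
  g \oc (f + f') = g \oc f + g \oc f'.
Proof. exact: linearD (mk_linear (comp_linearr g)) f f'. Qed.

Lemma compZm (X Y Z : C) a (g : hom Y Z) (f : hom X Y) :
  (a *: g) \oc f = a *: (g \oc f).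
Proof. exact: linearZ_LR (mk_linear (comp_linearl f)) a g. Qed.

Lemma compmZ (X Y Z : C) a (g : hom Y Z) (f : hom X Y) :
  g \oc (a *: f) = a *: (g \oc f).
Proof. exact: linearZ_LR (mk_linear (comp_linearr g)) a f. Qed.

Lemma comp_suml n (X Y Z : C) (F : 'I_n -> hom Y Z) (f : hom X Y) :
  (\sum_i F i) \oc f = \sum_i (F i \oc f).
Proof. exact: (raddf_sum (mk_linear (comp_linearl f))). Qed.

Lemma comp_sumr n (X Y Z : C) (g : hom Y Z) (F : 'I_n -> hom X Y) :
  g \oc (\sum_i F i) = \sum_i (g \oc F i).
Proof. exact: (raddf_sum (mk_linear (comp_linearr g))). Qed.

Lemma is_iso_id (X : C) : is_iso (idm X).
Proof. by exists (idm X); rewrite comp1m. Qed.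

Lemma is_iso_comp (X Y Z : C) (g : hom Y Z) (f : hom X Y) :
  is_iso g -> is_iso f -> is_iso (g \oc f).
Proof.
move=> [g' [g'g gg']] [f' [f'f ff']]; exists (f' \oc g'); split.
  by rewrite -compA (compA g') g'g comp1m.
by rewrite -compA (compA f) ff' comp1m.
Qed.

Lemma section_retraction_iso (X Y : C) (f : hom X Y) :
  is_section f -> is_retraction f -> is_iso f.
Proof.
move=> [r rf] [s fs]; exists r; split=> //.
by rewrite -[r]compm1 -fs (compA r) rf comp1m.
Qed.

Section Local.
Variable X : C.
Hypothesis Xl : strongly_indecomposable X.

(** If [r] is a left inverse of [f], one of the idempotents [f \oc r] and [idm X - f \oc r] is
    invertible. The first case makes [f] a retraction too; in the second [f = 0], since the
    complement kills [f]. *)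
Lemma local_section_iso (f : hom X X) : is_section f -> is_iso f.
Proof.
case: Xl => X0 Xs [r rf]; apply: contrapT => If.
have [Ifr|Ifr] := EM (is_iso (f \oc r)).
  apply: If; apply: section_retraction_iso; first by exists r.
  by case: Ifr => g [_ fg]; exists (r \oc g); rewrite compA.
have [Ifr'|Ifr'] := EM (is_iso (idm X - f \oc r)); last first.
  by apply: (Xs _ _ Ifr Ifr'); rewrite addrC subrK; apply: is_iso_id.
case: Ifr' => g [gf _]; apply: X0.
rewrite -rf -[f]comp1m -gf -(compA g) comp_subl comp1m -(compA f) rf compm1.
by rewrite subrr compm0 compm0.
Qed.

Lemma local_comp_iso (f g : hom X X) : is_iso (g \oc f) -> is_iso f.
Proof.
case=> h [hgf _]; apply: local_section_iso; exists (h \oc g).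
by rewrite -compA.
Qed.

Lemma local_noniso_sub (f : hom X X) : ~ is_iso f -> is_iso (idm X - f).
Proof.
move=> If; apply: contrapT => If'; case: Xl => _ /(_ _ _ If If'); apply.
by rewrite addrC subrK; apply: is_iso_id.
Qed.

Lemma noniso0 : ~ is_iso (0 : hom X X).
Proof. by case: Xl => X0 _ [g [g0 _]]; apply: X0; rewrite -g0 compm0. Qed.

(** With [noniso0] this makes the non-isomorphisms an R-submodule, to which the separation of forms
    can be applied. *)
Lemma noniso_lin a (f g : hom X X) :
  ~ is_iso f -> ~ is_iso g -> ~ is_iso (a *: f + g).
Proof.
move=> If; case: Xl => _; apply.
case=> h [hf fh]; apply: If; exists (a *: h).
by rewrite compZm -compmZ hf compmZ -compZm fh.
Qed.

End Local.

Lemma local_retraction_iso (X : C) (f : hom X X) :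
  strongly_indecomposable X -> is_retraction f -> is_iso f.
Proof.
move=> Xl [s fs]; have [r [rs sr]] := local_section_iso Xl (ex_intro _ f fs).
have <- : r = f by rewrite -[f]compm1 -sr compA fs comp1m.
by exists s.
Qed.

End LinearCategory.

(** * Splittings, the five lemma and direct sums *)

Section ExtCategory.
Local Open Scope ring_scope.
Variables (R : comPzRingType) (C : extCat R).

Lemma pre0 (X Y M : C) (f : hom X Y) : (0 : ext Y M) \pc f = 0.
Proof. exact: linear0 (mk_linear (pre_linear (M := M) f)). Qed.

Lemma prem0 (X Y M : C) (e : ext Y M) : e \pc (0 : hom X Y) = 0.
Proof. exact: linear0 (mk_linear (pre_linearr (X := X) e)). Qed.

Lemma post0 (M X Y : C) (f : hom X Y) : f \ac (0 : ext M X) = 0.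
Proof. exact: linear0 (mk_linear (post_linear (M := M) f)). Qed.

Lemma post0m (M X Y : C) (e : ext M X) : (0 : hom X Y) \ac e = 0.
Proof. exact: linear0 (mk_linear (post_linearl (Y := Y) e)). Qed.

Lemma preB (X Y M : C) (e : ext Y M) (f g : hom X Y) :
  e \pc (f - g) = e \pc f - e \pc g.
Proof. exact: linearB (mk_linear (pre_linearr (X := X) e)) f g. Qed.

Lemma postB (M X Y : C) (e : ext M X) (f g : hom X Y) :
  (f - g) \ac e = f \ac e - g \ac e.
Proof. exact: linearB (mk_linear (post_linearl (Y := Y) e)) f g. Qed.

Lemma pre_sum n (X Y M : C) (e : ext Y M) (F : 'I_n -> hom X Y) :
  e \pc (\sum_i F i) = \sum_i (e \pc F i).
Proof. exact: (raddf_sum (mk_linear (pre_linearr (X := X) e))). Qed.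

Lemma post_sum n (M X Y : C) (e : ext M X) (F : 'I_n -> hom X Y) :
  (\sum_i F i) \ac e = \sum_i (F i \ac e).
Proof. exact: (raddf_sum (mk_linear (post_linearl (Y := Y) e))). Qed.

(** A right inverse of [g] would recover [e] from its pullback along [g], which is zero. *)
Lemma conf_retraction (X Y Z : C) (f : hom X Y) (g : hom Y Z) (e : ext Z X) :
  conflation f g e -> e <> 0 -> ~ is_retraction g.
Proof.
move=> cf e0 [s gs]; apply: e0.
by rewrite -[e]pre1 -gs preA (conf_pre cf) pre0.
Qed.

(** One half of the five lemma; the other half is this statement in the opposite category. *)
Lemma conf_fill_retraction (X Y Z : C) (f : hom X Y) (g : hom Y Z) (e : ext Z X)
    (X' Y' Z' : C) (f' : hom X' Y') (g' : hom Y' Z') (e' : ext Z' X')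
    (a : hom X X') (b : hom Y Y') (c : hom Z Z') :
  conflation f g e -> conflation f' g' e' ->
  b \oc f = f' \oc a -> c \oc g = g' \oc b -> a \ac e = e' \pc c ->
  is_iso a -> is_iso c -> is_retraction b.
Proof.
move=> cf cf' ba cb ae [a' [a'a aa']] [c' [c'c cc']].
(* The pullback of [e] along [c' \oc g'] vanishes, so this composite lifts through [g] to a first
   approximation of a right inverse of [b]. *)
have [] := @conf_lift _ _ _ _ _ _ _ _ cf _ (c' \oc g').
  rewrite -[LHS]post1 -a'a postA -post_pre ae -preA compA cc' comp1m.
  by rewrite (conf_pre cf') post0.
(* The defect of [y] is killed by [g'], hence comes from [X'], and is corrected by a map through
   [f]. *)
move=> y gy; have [|x fx] := @conf_ker _ _ _ _ _ _ _ _ cf' _ (idm _ - b \oc y).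
  by rewrite comp_subr compm1 compA -cb -compA gy compA cc' comp1m subrr.
exists (y + f \oc (a' \oc x)).
rewrite compmD (compA b) ba -(compA f') (compA a) aa' comp1m fx.
by rewrite addrC subrK.
Qed.

End ExtCategory.

Section OrdCase.
Variables (n : nat) (P : 'I_n.+1 -> Type).
Variables (a : P ord0) (b : forall j, P (lift ord0 j)).

(** The casts are forced by the dependency of [P] on the index: the inclusions and projections of a
    direct sum have types that vary with the summand. *)
Definition ord_case k : P k :=
  match unliftP ord0 k with
  | UnliftSome j e => ecast i (P i) (esym e) (b j)
  | UnliftNone e => ecast i (P i) (esym e) a
  end.

Lemma ord_case0 : ord_case ord0 = a.
Proof.
rewrite /ord_case; case: (unliftP ord0 ord0) => [j e|e].
  by case/eqP: (neq_lift ord0 j).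
by rewrite (eq_irrelevance e (erefl ord0)).
Qed.

Lemma ord_caseS j : ord_case (lift ord0 j) = b j.
Proof.
rewrite /ord_case; case: (unliftP ord0 (lift ord0 j)) => [m e|e].
  have jm := lift_inj e; case: m / jm e => e.
  by rewrite (eq_irrelevance e (erefl _)).
by case/eqP: (neq_lift ord0 j).
Qed.

End OrdCase.

Section ExtCategory2.
Local Open Scope ring_scope.
Variables (R : comPzRingType) (C : extCat R).

Lemma conf_section (X Y Z : C) (f : hom X Y) (g : hom Y Z) (e : ext Z X) :
  conflation f g e -> e <> 0 -> ~ is_section f.
Proof. exact: (@conf_retraction _ (op C)). Qed.

Lemma conf_fill_iso (X Y Z : C) (f : hom X Y) (g : hom Y Z) (e : ext Z X)
    (X' Y' Z' : C) (f' : hom X' Y') (g' : hom Y' Z') (e' : ext Z' X')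
    (a : hom X X') (b : hom Y Y') (c : hom Z Z') :
  conflation f g e -> conflation f' g' e' ->
  b \oc f = f' \oc a -> c \oc g = g' \oc b -> a \ac e = e' \pc c ->
  is_iso a -> is_iso c -> is_iso b.
Proof.
move=> cf cf' ba cb ae Ia Ic; apply: section_retraction_iso; last first.
  exact: conf_fill_retraction cf cf' ba cb ae Ia Ic.
apply: (@conf_fill_retraction _ (op C) _ _ _ _ _ _ _ _ _ _ _ _ _ _ _
  cf' cf (esym cb) (esym ba) (esym ae)); exact/op_iso.
Qed.

(** The conflation with class 0 splits on both sides. The projection to [X] is obtained by factoring
    [idm S - s \oc g] through [f]. *)
Lemma biproduct_exists (X Y : C) :
  exists (S : C) (i1 : hom X S) (i2 : hom Y S) (p1 : hom S X) (p2 : hom S Y),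
    [/\ p1 \oc i1 = idm X, p2 \oc i2 = idm Y, p1 \oc i2 = 0, p2 \oc i1 = 0 &
        i1 \oc p1 + i2 \oc p2 = idm S].
Proof.
have [S [f [g cf]]] := realize (0 : ext Y X).
have [s gs] := conf_lift cf (pre0 X (idm Y)).
have [r rf] := conf_extend cf (post0 Y (idm X)).
have gf := conf_comp cf.
have [|p fp] := @conf_ker _ _ _ _ _ _ _ _ cf _ (idm S - s \oc g).
  by rewrite comp_subr compm1 compA gs comp1m subrr.
have fI W (x y : hom W X) : f \oc x = f \oc y -> x = y.
  by move=> /(congr1 (comp r)); rewrite !compA rf !comp1m.
exists S, f, s, p, g; split=> //.
- by apply: fI; rewrite compA fp comp_subl comp1m -compA gf compm0 subr0 compm1.
- by apply: fI; rewrite compA fp comp_subl comp1m -compA gs compm1 subrr compm0.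
- by rewrite fp subrK.
Qed.

Lemma direct_sum_exists n (E : 'I_n -> C) : exists X : C, direct_sum X E.
Proof.
elim: n E => [|n IHn] E.
  exists (ezero C), (fun k => 0), (fun k => 0).
  by split=> [[]//|[]//|]; rewrite big_ord0 (ezeroP C).
have [X [i [p [pi pi0 ip]]]] := IHn (fun k => E (lift ord0 k)).
have [S [i1 [i2 [p1 [p2 [p11 p22 p12 p21 ii]]]]]] := biproduct_exists (E ord0) X.
pose F k : hom (E k) S * hom S (E k) :=
  ord_case (P := fun k => (hom (E k) S * hom S (E k))%type)
    (i1, p1) (fun j => (i2 \oc i j, p j \oc p2)) k.
exists S, (fun k => (F k).1), (fun k => (F k).2); split.
- move=> k; case: (unliftP ord0 k) => [j ->|->].
    by rewrite /F ord_caseS /= -compA (compA p2) p22 comp1m pi.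
  by rewrite /F ord_case0.
- move=> k l; case: (unliftP ord0 k) => [j ->|->];
    case: (unliftP ord0 l) => [m ->|->]; rewrite /F ?ord_case0 ?ord_caseS //=.
  + rewrite (inj_eq lift_inj) => jm.
    by rewrite -compA (compA p2) p22 comp1m pi0.
  + by rewrite -compA p21 compm0.
  + by rewrite compA p12 comp0m.
- rewrite big_ord_recl /F ord_case0 /= -[RHS]ii -[in RHS](comp1m p2) -ip.
  rewrite comp_suml comp_sumr; congr (_ + _); apply: eq_bigr => j _.
  by rewrite ord_caseS /= !compA.
Qed.

End ExtCategory2.

(** * Representing forms and almost split sequences *)

Section Representability.
Local Open Scope ring_scope.
Variables (R : comPzRingType) (I : lmodType R) (C : extCat R).

(** In [tri_ext C] these are the projectively trivial morphisms, in its opposite the injectively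
    trivial ones. *)
Definition ext_trivial_pre (X Y : C) (f : hom X Y) : Prop :=
  forall (M : C) (e : ext Y M), e \pc f = 0.

(* In a tri-exact category, S = T[1]; being universal on both sides makes the
   notion self-dual: for the opposite category it says T = S[-1].            *)
Definition suspension (T S : C) (s : ext S T) : Prop :=
  (forall Y, bijective (fun f : hom Y S => s \pc f)) /\
  (forall M, bijective (fun t : hom T M => t \ac s)).

Definition has_suspensions : Prop :=
  forall T : C, exists (S : C) (s : ext S T), suspension s.

Definition represents (Z T : C) (th : {linear ext Z T -> I}) : Prop :=
  (forall Y (f : hom Z Y), (forall e : ext Y T, th (e \pc f) = 0) -> ext_trivial_pre f) /\
  (forall Y (psi : {linear ext Y T -> I}),
     exists f : hom Z Y, forall e, psi e = th (e \pc f)).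

Definition conf_projective (Z : C) : Prop := forall (M : C) (e : ext Z M), e = 0.

Definition almost_split_conflation (X Y Z : C) (f : hom X Y) (g : hom Y Z) : Prop :=
  [/\ exists e, conflation f g e,
      minimal_left_almost_split f & minimal_right_almost_split g].

Definition has_almost_split_right : Prop :=
  forall Z : C, strongly_indecomposable Z -> ~ conf_projective Z ->
    exists (X Y : C) (f : hom X Y) (g : hom Y Z), almost_split_conflation f g.

Hypothesis cogI : cogenerator I.

(** The cogenerator would detect a non-zero [e] by a form on [ext Y T], and every such form comes
    from a morphism [f]. *)
Lemma represents_nondegenerate (Z T : C) (th : {linear ext Z T -> I}) (Y : C)
    (e : ext Y T) :
  represents th -> (forall f : hom Z Y, th (e \pc f) = 0) -> e = 0.
Proof.
move=> [_ ths] e0; apply: contrapT => /cogI[psi]; apply.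
by have [f ->] := ths _ psi.
Qed.

(** A morphism into a suspension is determined by the pullback of the universal class [s]. *)
Lemma susp_trivial_pre (T S X : C) (s : ext S T) (f : hom X S) :
  suspension s -> ext_trivial_pre f -> f = 0.
Proof. by move=> [/(_ X)/bij_inj sI _] /(_ _ s) f0; apply: sI; rewrite prem0. Qed.

(** Pulling back the class of a suspension [S] of [T] identifies [hom Y S] with [ext Y T]. *)
Lemma ext_reflexive (Y T : C) :
  hom_reflexive C I -> has_suspensions -> reflexive_module I (ext Y T).
Proof.
move=> hr /(_ T)[S [s [sY _]]].
exact: (reflexive_iso (f := mk_linear (pre_linearr s)) (sY Y) (hr Y S)).
Qed.

Hypotheses (hr : hom_reflexive C I) (hs : has_suspensions).

(** Trivial morphisms into [S] vanish, so [th] identifies [hom Z S] with the full dual of [ext S T].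
    Thus [al] becomes a form on that dual, and reflexivity makes it evaluation at a point [x]. *)
Lemma represents_corep (Z T T' S : C) (th : {linear ext Z T -> I}) (s : ext S T')
    (al : {linear hom Z S -> I}) :
  represents th -> suspension s ->
  exists x : ext S T, forall f, al f = th (x \pc f).
Proof.
move=> [thi ths] ss; pose ph (f : hom Z S) : dual I (ext S T) :=
  (th \o mk_linear (pre_linear (M := T) f) : ext S T -> I).
have phl : linear ph.
  by move=> a f g; apply: dual_ext => e /=; rewrite pre_linearr linearP.
have phb : bijective ph.
  apply: inj_surj_bijective => [f g fg|y].
    apply/eqP; rewrite -subr_eq0; apply/eqP.
    apply: (susp_trivial_pre ss); apply: thi => e.
    have := congr1 (fun y : {linear ext S T -> I} => y e) fg => /= Ee.
    by rewrite preB linearB /= Ee subrr.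
  have [f fE] := ths _ y; exists f.
  by apply: dual_ext => e; rewrite fE.
case: phb => ps psK Kps.
have psl : linear ps.
  by move=> a u v; apply: (can_inj psK); rewrite phl !Kps.
have [b _ bK] := ext_reflexive S T hr hs.
pose F : {linear dual I (ext S T) -> I} := al \o mk_linear psl.
exists (b F) => f; have := congr1 (fun G : {linear dual I (ext S T) -> I} => G (ph f)) (bK F).
by rewrite /= /bidual_map /= psK => <-.
Qed.

(* Shifting the variable object by one turns the pairing Hom(Z,Y) x Ext(Y,T)
   into Ext(Z,Y) x Hom(Y,T). *)
Lemma represents_op (Z T : C) (th : {linear ext Z T -> I}) : represents th ->
  (forall Y (f : hom Y T), (forall e : ext Z Y, th (f \ac e) = 0) -> f = 0) /\
  (forall Y (psi : {linear ext Z Y -> I}),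
     exists f : hom Y T, forall e, psi e = th (f \ac e)).
Proof.
move=> rth; split=> Y.
  move=> f f0; have [S [s [spre spost]]] := hs Y.
  apply: (bij_inj (spost T)); rewrite post0m.
  by apply: (represents_nondegenerate rth) => g; rewrite post_pre f0.
move=> psi; have [S [s ss]] := hs Y.
(* Through [s], the form [psi] on [ext Z Y] is a form on [hom Z S]; the class [x] representing it is
   the push-forward of [s] along a unique map [Y -> T]. *)
have [x xE] := represents_corep (psi \o mk_linear (pre_linearr (X := Z) s)) rth ss.
case: ss => spre spost; have [t _ tK] := spost T; have [g _ gK] := spre Z.
exists (t x) => e; rewrite -[e]gK; have /= -> := xE (g e).
by rewrite -{1}[x]tK post_pre.
Qed.

(** The map [t] is the transpose of [u] under the two forms; translates will act on morphisms in
    this way. *)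
Lemma represents_hom (Z T Z' T' : C) (th : {linear ext Z T -> I})
    (th' : {linear ext Z' T' -> I}) (u : hom Z' Z) :
  represents th -> exists t : hom T' T, forall e, th (t \ac e) = th' (e \pc u).
Proof.
move=> /represents_op[_] /(_ T' (th' \o mk_linear (pre_linear (M := T') u)))[t tE].
by exists t => e; rewrite -tE.
Qed.

Lemma represents_hom_inj (Z T T' : C) (th : {linear ext Z T -> I}) (t t' : hom T' T) :
  represents th -> (forall e, th (t \ac e) = th (t' \ac e)) -> t = t'.
Proof.
move=> /represents_op[thi _] tt'; apply/eqP; rewrite -subr_eq0; apply/eqP.
by apply: thi => e; rewrite postB linearB tt' subrr.
Qed.

(** The transposes of the identity of [Z] in both directions are mutually inverse, because
    transposes are unique. *)
Lemma represents_uniq (Z T T' : C) (th : {linear ext Z T -> I})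
    (th' : {linear ext Z T' -> I}) :
  represents th -> represents th' -> exists t : hom T' T, is_iso t.
Proof.
move=> r r'; have [t tE] := represents_hom th' (idm Z) r.
have [t' tE'] := represents_hom th (idm Z) r'.
exists t, t'; split.
  by apply: (represents_hom_inj r') => e; rewrite postA tE' pre1 tE pre1 post1.
by apply: (represents_hom_inj r) => e; rewrite postA tE pre1 tE' pre1 post1.
Qed.

Lemma represents_iso (Z T T' : C) (th : {linear ext Z T -> I}) (t : hom T T') :
  is_iso t -> represents th -> exists th' : {linear ext Z T' -> I}, represents th'.
Proof.
move=> [t' [t't tt']] [thi ths].
exists (th \o mk_linear (post_linear (M := Z) t')); split=> Y.
  move=> f f0; apply: thi => e.
  by have := f0 (t \ac e); rewrite /= -post_pre -postA t't post1.
move=> psi; have [f fE] := ths Y (psi \o mk_linear (post_linear (M := Y) t)).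
exists f => e; by rewrite /= -post_pre -fE /= -postA tt' post1.
Qed.

(** The representing object is the direct sum of the [T k], and the form is the sum of the [th k] on
    the diagonal components. *)
Lemma represents_direct_sum n (Z : C) (E : 'I_n -> C) :
  direct_sum Z E ->
  (forall k, exists (T : C) (th : {linear ext (E k) T -> I}), represents th) ->
  exists (S : C) (th : {linear ext Z S -> I}), represents th.
Proof.
move=> [i [p [pi pi0 ip]]] rep.
pose T k := sval (cid (rep k)); pose th k := sval (cid (svalP (cid (rep k)))).
have thP k : represents (th k) := svalP (cid (svalP (cid (rep k)))).
have [S [j [q [qj qj0 jq]]]] := direct_sum_exists T.
pose h (e : ext Z S) := \sum_k th k (q k \ac (e \pc i k)).
have hl : linear h.
  move=> a e e'; rewrite /h scaler_sumr -big_split; apply: eq_bigr => k _ /=.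
  by rewrite pre_linear post_linear linearP.
(* On classes from the [k]-th summand, [h] sees only the [k]-th component of [f], so both conditions
   can be checked summand by summand. *)
have hj Y k (e : ext Y (T k)) (f : hom Z Y) :
    h ((j k \ac e) \pc f) = th k (e \pc (f \oc i k)).
  rewrite /h (bigD1 k) //= big1 ?addr0 => [|l lk].
    by rewrite -preA post_pre -postA qj post1.
  by rewrite -preA post_pre -postA qj0 // post0m linear0.
exists S, (mk_linear hl); split=> Y.
  move=> f f0 M e; rewrite -[f]compm1 -ip comp_sumr pre_sum big1 // => k _.
  rewrite compA preA.
  suff -> : e \pc (f \oc i k) = 0 by rewrite pre0.
  by apply: (thP k).1 => e'; rewrite -hj; apply: f0.
move=> psi.
have /(_ _)/cid F k : exists f : hom (E k) Y, forall e, psi (j k \ac e) = th k (e \pc f).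
  by have [f] := (thP k).2 Y (psi \o mk_linear (post_linear (M := Y) (j k))); exists f.
exists (\sum_k sval (F k) \oc p k) => e /=.
rewrite -{1}[e]post1 -jq post_sum linear_sum /h; apply: eq_bigr => k _.
rewrite postA (svalP (F k)) -preA comp_suml (bigD1 k) //=.
rewrite big1 ?addr0 => [|l lk]; last by rewrite -compA pi0 // compm0.
by rewrite -compA pi compm1 post_pre.
Qed.

(** The zero form works: all morphisms out of [Z] are trivial, and every [ext Y (ezero C)] is
    zero. *)
Lemma represents_projective (Z : C) : conf_projective Z ->
  exists (T : C) (th : {linear ext Z T -> I}), represents th.
Proof.
move=> Zp; exists (ezero C), (0 : dual I (ext Z (ezero C))).
split=> Y; first by move=> f _ M e; apply: Zp.
move=> psi; exists 0 => e /=.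
by rewrite -[e]post1 (ezeroP C) post0m linear0.
Qed.

Lemma represents_almost_split (X Y Z : C) (f : hom X Y) (g : hom Y Z) :
  almost_split_conflation f g -> exists th : {linear ext Z X -> I}, represents th.
Proof.
move=> [[e cf] [_ [fs fas]] [_ [gr gas]]].
have /cogI[th the] : e <> 0.
  by move=> e0; apply: gr; apply: (conf_lift cf (h := idm Z)); rewrite e0 pre0.
exists th; split=> W.
  move=> f1 f10 M y; apply: contrapT => yf0.
  have [E [f2 [g2 cf2]]] := realize (y \pc f1).
  (* A non-zero pullback of [y] along [f1] has a non-split conflation, so its deflation factors
     through [g]; filling on the left pushes this class forward to [e]. *)
  have [k kE] := gas _ _ (conf_retraction cf2 yf0).
  have [|a [_ aE]] := conf_filll (b := k) (c := idm Z) cf2 cf; first by rewrite comp1m kE.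
  by apply: the; rewrite -[e]pre1 -aE -post_pre f10.
move=> psi; apply: contrapT => npsi.
pose ev (f1 : hom Z W) : dual I (ext W X) :=
  (th \o mk_linear (pre_linear (M := X) f1) : ext W X -> I).
have evE f1 x : (ev f1 : {linear _ -> _}) x = th (x \pc f1) by [].
(* If no morphism gives [psi], some [x] is killed by all forms [ev f1] but not by [psi]. Being
   non-zero, [x] pulls back to [e], and then [th e = 0]. *)
have [|||x [px xP]] := @reflexive_separate _ _ cogI (ext W X)
  (fun y => exists f1, ev f1 = y) psi (ext_reflexive W X hr hs).
- by exists 0; apply: dual_ext => x; rewrite evE prem0 linear0.
- move=> a _ _ [f1 <-] [f2 <-]; exists (a *: f1 + f2); apply: dual_ext => x.
  by rewrite evE pre_linearr linearP.
- by case=> f1 f1E; apply: npsi; exists f1 => x; rewrite -f1E.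
have x0 : x <> 0 by move=> x0; apply: px; rewrite x0 linear0.
have [E [f2 [g2 cf2]]] := realize x.
have [k kE] := fas _ _ (conf_section cf2 x0).
have [|c [_ cE]] := conf_fillr (a := idm X) (b := k) cf cf2; first by rewrite compm1 kE.
apply: the; rewrite -[e]post1 cE; exact: (xP (ev c) (ex_intro _ c erefl)).
Qed.

(** Krull-Schmidt decomposition reduces to strongly indecomposable summands, which are
    Ext-projective or end an almost split sequence. *)
Lemma almost_split_represents :
  krull_schmidt C -> has_almost_split_right ->
  forall Z : C, exists (T : C) (th : {linear ext Z T -> I}), represents th.
Proof.
move=> KS AS Z; have [Z0|/KS[n [E [ZE El]]]] := EM (zero_object Z).
  by apply: represents_projective => M e; rewrite -[e]pre1 Z0 prem0.
apply: (represents_direct_sum ZE) => k.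
have [|/(AS _ (El k))[X [Y [f [g fg]]]]] := EM (conf_projective (E k)).
  exact: represents_projective.
by exists X; apply: represents_almost_split fg.
Qed.

Lemma represents_strongly_indecomposable (Z T : C) (th : {linear ext Z T -> I}) :
  strongly_indecomposable Z -> ~ conf_projective Z -> represents th ->
  exists (Y : C) (f : hom T Y) (g : hom Y Z), almost_split_conflation f g.
Proof.
move=> Zl Zp rth.
pose ev (f : hom Z Z) : dual I (ext Z T) :=
  (th \o mk_linear (pre_linear (M := T) f) : ext Z T -> I).
have evE f x : (ev f : {linear _ -> _}) x = th (x \pc f) by [].
(* The form of the identity is separated from the submodule of forms of non-isomorphisms. *)
have [|||e [ne eP']] := @reflexive_separate _ _ cogI (ext Z T)
  (fun y => exists f, ~ is_iso f /\ ev f = y) (ev (idm Z)) (ext_reflexive Z T hr hs).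
- by exists 0; split; [apply: noniso0 | apply: dual_ext => x; rewrite evE prem0 linear0].
- move=> a _ _ [f [If <-]] [g [Ig <-]]; exists (a *: f + g).
  split; first exact: noniso_lin.
  by apply: dual_ext => x; rewrite evE pre_linearr linearP.
(* If the identity and a non-isomorphism [f] gave the same form, the isomorphism [idm Z - f] would
   be trivial and [Z] Ext-projective. *)
- move=> [f [If fE]]; apply: Zp => M e; have [f' [_ ff']] := local_noniso_sub Zl If.
  rewrite -[e]pre1 -ff' preA; suff -> : e \pc (idm Z - f) = 0 by rewrite pre0.
  apply: (rth.1) => x; rewrite preB linearB -evE -fE evE; exact: subrr.
have the : th e <> 0.
  by move=> te; apply: ne; rewrite -te -[in RHS](pre1 e).
have eP f : ~ is_iso f -> th (e \pc f) = 0.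
  by move=> If; apply: (eP' (ev f)); exists f.
have e0 : e <> 0 by move=> e0; apply: the; rewrite e0 linear0.
(* The class [e] lies in the socle: if [h] is no retraction, neither is any [h \oc f], so the
   pullback along [h] pairs to zero with every [f]. *)
have esoc M (h : hom M Z) : ~ is_retraction h -> e \pc h = 0.
  move=> hr'; apply: (represents_nondegenerate rth) => f; rewrite -preA.
  by apply: eP => -[k [_ hk]]; apply: hr'; exists (f \oc k); rewrite compA.
have tiso (t : hom T T) : t \ac e <> 0 -> is_iso t.
  (* The endomorphism [u] of [Z] is adjoint to [t]. If it is invertible, so is [t]; otherwise every
     [f \oc u] is a non-isomorphism, which forces [t \ac e = 0]. *)
  move=> te0; have [u uE] := rth.2 _ (th \o mk_linear (post_linear (M := Z) t)).
  have /= {}uE x : th (t \ac x) = th (x \pc u) by rewrite -uE.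
  have [[u' [u'u uu']]|Iu] := EM (is_iso u).
    have [t' tE'] := represents_hom th u' rth; exists t'.
    split; apply: (represents_hom_inj rth) => x.
      by rewrite postA tE' post_pre uE -preA u'u pre1 post1.
    by rewrite postA uE post_pre tE' -preA uu' pre1 post1.
  case: te0; apply: (represents_nondegenerate rth) => f.
  rewrite post_pre uE -preA; apply: eP => Ifu; apply: Iu.
  exact: local_comp_iso Ifu.
have [Y [f [g cf]]] := realize e.
exists Y, f, g; split; first by exists e.
  split.
    (* The induced [c] fixes [e], hence is a retraction by [esoc] and an isomorphism by locality;
       the five lemma then applies to [h]. *)
    move=> h hf; have [|c [cE ec]] := conf_fillr (a := idm T) (b := h) cf cf.
      by rewrite compm1.
    have Ic : is_iso c.
      apply: local_retraction_iso => //; apply: contrapT => /esoc ec0.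
      by apply: e0; rewrite -[e]post1 ec.
    by apply: (conf_fill_iso cf cf _ cE ec) => //; [rewrite compm1 | apply: is_iso_id].
  split=> [|M u us]; first exact: conf_section cf e0.
  (* If [u \ac e] were non-zero, a form detecting it would be [th] composed with some [v]; then
     [v \oc u] would be invertible and [u] a section. *)
  apply: (conf_extend cf); apply: contrapT => /cogI[psi].
  have [v ->] := (represents_op rth).2 _ psi => vue.
  have [|w [wvu _]] := tiso (v \oc u).
    by move=> vue0; apply: vue; rewrite -postA vue0 linear0.
  by apply: us; exists (w \oc v); rewrite -compA.
split.
  move=> h hg; have [|a [aE ae]] := conf_filll (b := h) (c := idm Z) cf cf.
    by rewrite comp1m.
  have Ia : is_iso a by apply: tiso; rewrite ae pre1.
  by apply: (conf_fill_iso cf cf aE _ ae) => //; [rewrite comp1m | apply: is_iso_id].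
split=> [|M h /esoc]; first exact: conf_retraction cf e0.
exact: (conf_lift cf).
Qed.

Lemma almost_split_rightP : krull_schmidt C ->
  has_almost_split_right <->
  forall Z : C, exists (T : C) (th : {linear ext Z T -> I}), represents th.
Proof.
move=> KS; split=> [|rep Z Zl Zp]; first exact: almost_split_represents.
have [T [th rth]] := rep Z.
by exists T; apply: represents_strongly_indecomposable rth.
Qed.

End Representability.

(** * Triangulated and tri-exact categories *)

Section Equivalences.
Variables (R : comPzRingType) (C D : linCat R).

Lemma iso_cancelr (X Y Z : C) (a : hom X Y) (f g : hom Y Z) :
  is_iso a -> f \oc a = g \oc a -> f = g.
Proof.
by case=> b [_ ab] /(congr1 (fun h => h \oc b)); rewrite -!compA ab !compm1.
Qed.

Lemma iso_cancell (X Y Z : C) (a : hom Y Z) (f g : hom X Y) :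
  is_iso a -> a \oc f = a \oc g -> f = g.
Proof.
by case=> b [ba _] /(congr1 (comp b)); rewrite !compA ba !comp1m.
Qed.

Lemma nat_isomorphic_faithful (F : functor C D) (G : functor D C) :
  nat_isomorphic (comp_functor G F) (id_functor C) ->
  forall (X Y : C) (f g : hom X Y), fhom F f = fhom F g -> f = g.
Proof.
move=> [a [Ia aN]] X Y f g fg; apply: (iso_cancelr (Ia X)).
by have := aN _ _ f; have /= -> := aN _ _ g; rewrite /= fg.
Qed.

Lemma fhom_iso (F : functor C D) (X Y : C) (f : hom X Y) : is_iso f -> is_iso (fhom F f).
Proof. by case=> g [gf fg]; exists (fhom F g); rewrite -!fhomM gf fg !fhom1. Qed.

Lemma is_equivalence_surj (F : functor C D) :
  is_equivalence F -> forall Y : D, exists (X : C) (a : hom (F X) Y), is_iso a.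
Proof. by move=> [G [_ [b [Ib _]]]] Y; exists (G Y), (b Y); apply: Ib. Qed.

Lemma fully_faithful_equivalence (F : functor C D) :
  (forall (X Y : C) (f g : hom X Y), fhom F f = fhom F g -> f = g) ->
  (forall (X Y : C) (g : hom (F X) (F Y)), exists f : hom X Y, fhom F f = g) ->
  (forall Y : D, exists (X : C) (a : hom (F X) Y), is_iso a) ->
  is_equivalence F.
Proof.
move=> faith full /(_ _)/cid surj.
pose g Y := sval (surj Y); pose a Y : hom (F (g Y)) Y := sval (cid (svalP (surj Y))).
have Ia Y : is_iso (a Y) := svalP (cid (svalP (surj Y))).
have /(_ _)/cid bP Y := Ia Y; pose b Y := sval (bP Y).
have ba Y : b Y \oc a Y = idm _ := (svalP (bP Y)).1.
have ab Y : a Y \oc b Y = idm _ := (svalP (bP Y)).2.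
have fullb X Y (u : hom (F X) (F Y)) := cid (full X Y u).
pose lift X Y (u : hom (F X) (F Y)) := sval (fullb X Y u).
have liftK X Y (u : hom (F X) (F Y)) : fhom F (lift X Y u) = u := svalP (fullb X Y u).
pose gh X Y (u : hom X Y) : hom (g X) (g Y) := lift (g X) (g Y) (b Y \oc u \oc a X).
have gh1 X : gh X X (idm X) = idm (g X).
  by apply: faith; rewrite liftK compm1 ba fhom1.
have ghM X Y Z (v : hom Y Z) (u : hom X Y) : gh X Z (v \oc u) = gh Y Z v \oc gh X Y u.
  apply: faith; rewrite fhomM !liftK -!compA; congr (_ \oc _); congr (_ \oc _).
  by rewrite (compA (a Y)) ab comp1m.
exists (Functor gh1 ghM); split; last first.
  exists a; split=> // X Y u /=.
  by rewrite liftK !compA ab comp1m.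
exists (fun X => lift (g (F X)) X (a (F X))); split=> [X|X Y u] /=; last first.
  by apply: faith; rewrite !fhomM !liftK !compA ab comp1m.
exists (lift X (g (F X)) (b (F X))).
by split; apply: faith; rewrite fhomM !liftK fhom1.
Qed.

End Equivalences.

Lemma equivalence_full (R : comPzRingType) (C D : linCat R) (F : functor C D)
    (G : functor D C) :
  nat_isomorphic (comp_functor G F) (id_functor C) ->
  nat_isomorphic (comp_functor F G) (id_functor D) ->
  forall (X Y : C) (g : hom (F X) (F Y)), exists f : hom X Y, fhom F f = g.
Proof.
move=> [a [Ia aN]] /nat_isomorphic_faithful faith X Y g.
(* The preimage is [fhom G g] conjugated by the isomorphism [a]; [faith] is the faithfulness of
   [G]. *)
have [b [ba ab]] := Ia X; exists (a Y \oc fhom G g \oc b); apply: faith.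
apply: (iso_cancell (Ia Y)); have /= <- := aN _ _ (a Y \oc fhom G g \oc b).
by rewrite -compA ba compm1.
Qed.

Lemma comp_equivalence (R : comPzRingType) (C D E : linCat R) (G : functor D E)
    (F : functor C D) :
  is_equivalence G -> is_equivalence F -> is_equivalence (comp_functor G F).
Proof.
move=> eG eF; have sG := is_equivalence_surj eG; have sF := is_equivalence_surj eF.
case: eG => G' [GG' G'G]; case: eF => F' [FF' F'F].
apply: fully_faithful_equivalence => [X Y f g|X Y g|Z].
- by move=> /(nat_isomorphic_faithful GG')/(nat_isomorphic_faithful FF').
- have [h <-] := equivalence_full GG' G'G g.
  by have [f <-] := equivalence_full FF' F'F h; exists f.
- have [Y [a Ia]] := sG Z; have [X [b Ib]] := sF Y.
  by exists X, (a \oc fhom G b); apply: is_iso_comp => //; apply: fhom_iso.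
Qed.

(** * Exactness in triangulated categories *)

Section Triangles.
Local Open Scope ring_scope.
Variables (R : comPzRingType) (A : triCat R).
Implicit Types X Y Z M : A.
Local Notation Sh := (fhom (shift A)).

Lemma shift_inj X Y (f g : hom X Y) : Sh f = Sh g -> f = g.
Proof. exact: nat_isomorphic_faithful (shiftK A) _ _ _ _. Qed.

Lemma shift_full X Y (g : hom (shift A X) (shift A Y)) : exists f, Sh f = g.
Proof. exact: equivalence_full (shiftK A) (unshiftK A) _ _ _. Qed.

Lemma shift0 X Y : Sh (0 : hom X Y) = 0.
Proof. exact: linear0 (mk_linear (@shift_linear R A X Y)). Qed.

Lemma shiftN X Y (f : hom X Y) : Sh (- f) = - Sh f.
Proof. exact: linearN (mk_linear (@shift_linear R A X Y)) f. Qed.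

Section Exactness.
Variables (X Y Z : A) (f : hom X Y) (g : hom Y Z) (h : hom Z (shift A X)).
Hypothesis fgh : exact_triangle f g h.

Lemma exact_rot1 : exact_triangle g h (- Sh f).
Proof. exact: (exact_rot f g h).1. Qed.

Lemma exact_rot2 : exact_triangle h (- Sh f) (- Sh g).
Proof. exact: (exact_rot _ _ _).1 exact_rot1. Qed.

(** A map from the trivial triangle on [X], given by the identity and [f], factors [g \oc f] through
    the zero object. *)
Lemma exact_comp : g \oc f = 0.
Proof.
have [|c [cE _]] := exact_fill (a := idm X) (b := f) (exact_id X) fgh; first by [].
by rewrite -cE compm0.
Qed.

(** A morphism from the rotated trivial triangle on [M] gives the shifted factorization; the shift
    is fully faithful. For [exact_coker] the morphism goes into such a triangle. *)
Lemma exact_ker M (k : hom M Y) : g \oc k = 0 -> exists l, f \oc l = k.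
Proof.
move=> gk; have e : exact_triangle (0 : hom M (zob A)) (0 : hom _ (shift A M)) (- Sh (idm M)).
  exact: (exact_rot _ _ _).1 (exact_id M).
have [|c [_]] := exact_fill (a := k) (b := 0) e exact_rot1.
  by rewrite gk compm0.
have [l <-] := shift_full c.
rewrite compmN compNm fhom1 compm1 => /oppr_inj; rewrite -fhomM => /shift_inj kE.
by exists l.
Qed.

Lemma exact_coker M (k : hom Y M) : k \oc f = 0 -> exists l, l \oc g = k.
Proof.
move=> kf.
have e : exact_triangle (0 : hom _ (shift A M)) (- Sh (idm M)) (- Sh (0 : hom M (zob A))).
  exact: (exact_rot _ _ _).1 ((exact_rot _ _ _).1 (exact_id M)).
have r : exact_triangle (- Sh f) (- Sh g) (- Sh h) :=
  (exact_rot _ _ _).1 exact_rot2.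
have [|c [cE _]] := exact_fill (a := 0) (b := Sh k) r e.
  by rewrite compmN -fhomM kf shift0 oppr0 comp0m.
have [l lE] := shift_full c; exists l; apply: shift_inj.
by move: cE; rewrite fhom1 compmN compNm comp1m -lE -fhomM => /oppr_inj.
Qed.

End Exactness.

Lemma exact_realize X Z (h : hom Z (shift A X)) :
  exists Y (f : hom X Y) (g : hom Y Z), exact_triangle f g h.
Proof.
have [W [u [v huv]]] := exact_cone h.
have [i [Ii _]] := unshiftK A.
have [j [ji ij]] := Ii W; have [f fE] := shift_full (- (j \oc u)).
have [g gE] := shift_full (- (v \oc i W)).
exists (unshift A W), f, g; apply: (exact_rot _ _ _).2.
apply: (exact_rot _ _ _).2; rewrite fE gE !opprK.
apply: (exact_iso (a := idm _) (b := idm _) (c := j) _ _ _ _ _ _ huv).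
- exact: is_iso_id.
- exact: is_iso_id.
- by exists (i W).
- by rewrite comp1m compm1.
- by rewrite compm1.
- by rewrite fhom1 comp1m -compA ij compm1.
Qed.

(** Rotation turns the missing first map into a missing third one, which is then unshifted. *)
Lemma exact_filll X Y Z (f : hom X Y) (g : hom Y Z) (h : hom Z (shift A X))
    X' Y' Z' (f' : hom X' Y') (g' : hom Y' Z') (h' : hom Z' (shift A X'))
    (b : hom Y Y') (c : hom Z Z') :
  exact_triangle f g h -> exact_triangle f' g' h' -> c \oc g = g' \oc b ->
  exists a : hom X X', b \oc f = f' \oc a /\ Sh a \oc h = h' \oc c.
Proof.
move=> /exact_rot1 t /exact_rot1 t' cb.
have [d [dE dE']] := exact_fill t t' cb.
have [a aE] := shift_full d; exists a; split; last by rewrite aE.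
apply: shift_inj; rewrite !fhomM aE; apply: oppr_inj.
by rewrite -compmN dE' compNm.
Qed.

End Triangles.

(** * Tri-exact categories as Ext structures *)

Section TriExactExt.
Local Open Scope ring_scope.
Variables (R : comPzRingType) (A : triCat R) (C : triExactCat A).

(** An isomorphism completes to a triangle with third term 0, an extension of 0 by [X]. *)
Lemma in_cat_iso (X Y : A) (f : hom X Y) : is_iso f -> in_cat C X -> in_cat C Y.
Proof.
move=> If CX.
apply: (@in_cat_ext _ _ C X Y (zob A) f 0 0) => //; last exact: in_cat0.
apply: (exact_iso (a := idm _) (b := f) (c := idm _) _ _ _ _ _ _ (exact_id X)) => //.
- exact: is_iso_id.
- exact: is_iso_id.
- by rewrite compm0 comp0m.
- by rewrite compm0 comp0m.
Qed.

Local Notation Sh := (fhom (shift A)).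

Definition tri_conflation (X Y Z : C) (f : hom X Y) (g : hom Y Z) (e : Ext1 Z X) : Prop :=
  @exact_triangle R A (sval X) (sval Y) (sval Z) f g e.

Fact tri_realize (Z X : C) (e : Ext1 Z X) :
  exists (Y : C) (f : hom X Y) (g : hom Y Z), tri_conflation f g e.
Proof.
have [Y [f [g fge]]] := exact_realize e.
by exists (exist _ Y (in_cat_ext fge (svalP X) (svalP Z))), f, g.
Qed.

(** Kept transparent, with sealed axioms, so that almost split sequences in [C] and almost split
    conflations agree by conversion. *)
Definition tri_ext : extCat R.
refine (@ExtCat R (tecat C) (@Ext1 R A C) (@ext_post R A C) (@ext_pre R A C)
  tri_conflation _ _ (@ext_post_comp _ _ C) (@ext_pre_comp _ _ C) _ _ _ _ _
  (exist _ (zob A) (in_cat0 C)) (zobP A) tri_realize _ _ _ _ _ _ _ _ _).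
- abstract (by move=> M X e; rewrite /ext_post fhom1; apply: comp1m).
- abstract (by move=> X M e; apply: compm1).
- abstract (by move=> W X Y Z f e g; apply/esym/compA).
- abstract (by move=> M X Y f a e e'; apply: (comp_linearr (Sh f))).
- abstract (by move=> M X Y e a f g; apply: ext_post_lin).
- abstract (by move=> X Y M f a e e'; apply: (comp_linearl (f : @hom R A _ _))).
- abstract (by move=> X Y M e a f g; apply: ext_pre_lin).
- abstract (by move=> X Y Z f g e; apply: exact_comp).
- abstract (by move=> X Y Z f g e /exact_rot1; apply: exact_comp).
- abstract (move=> X Y Z f g e /exact_rot2/exact_comp; rewrite compNm => /eqP;
    by rewrite oppr_eq0 => /eqP).
- abstract (by move=> X Y Z f g e /exact_rot1/exact_ker cf M; apply: cf).
- abstract (move=> X Y Z f g e /exact_rot2/exact_coker cf M h /cf[l];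
    have [k <-] := shift_full l; rewrite compmN -compNm -shiftN -fhomM => /shift_inj kE;
    by exists (- k)).
- abstract (by move=> X Y Z f g e /exact_ker cf M; apply: cf).
- abstract (by move=> X Y Z f g e /exact_coker cf M; apply: cf).
- abstract (move=> X Y Z f g e X' Y' Z' f' g' e' a b; exact: exact_fill).
- abstract (move=> X Y Z f g e X' Y' Z' f' g' e' a b; exact: exact_filll).
Defined.
(* Lets [tecat C] be recognized as the category underlying [tri_ext]. *)
Canonical tri_ext.

Lemma has_almost_split_rightE :
  has_almost_split_right tri_ext <-> has_almost_split_sequences_right C.
Proof. by []. Qed.

(** Only [is_iso], whose two equations are swapped in the opposite category, has to be
    translated. *)
Lemma has_almost_split_leftE :
  has_almost_split_right (op tri_ext) <-> has_almost_split_sequences_left C.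
Proof.
split=> AS X Xl Xi.
  have [|Z [Y [g [f [ex [gm gas] [fm fas]]]]]] := AS X _ Xi.
    exact/op_strongly_indecomposable.
  exists Y, Z, f, g; split=> //.
    by split=> // h hf; apply/op_iso; apply: fm.
  by split=> // h hg; apply/op_iso; apply: gm.
have /AS/(_ Xi)[Y [Z [f [g [ex [fm fas] [gm gas]]]]]] : strongly_indecomposable (X : C).
  exact/op_strongly_indecomposable.
exists Z, Y, g, f; split=> //.
  by split=> // h hg; apply/op_iso; apply: gm.
by split=> // h hf; apply/op_iso; apply: fm.
Qed.

Lemma iso_suspension (T S : C) (s : hom (sval S) (shift A (sval T))) :
  is_iso s -> @suspension R tri_ext T S s.
Proof.
move=> [r [rs sr]]; split=> [Y|M].
  exists (fun e : Ext1 Y T => r \oc e) => e; rewrite /= /ext_pre compA.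
    by rewrite rs comp1m.
  by rewrite sr comp1m.
have lP (e : Ext1 S M) := cid (shift_full (e \oc r)).
exists (fun e => sval (lP e)) => e.
  by apply: shift_inj; rewrite (svalP (lP _)) /= /ext_post -compA sr compm1.
by rewrite /= /ext_post (svalP (lP _)) -compA rs compm1.
Qed.

Lemma right_triangulated_shift (X : A) :
  right_triangulated C -> in_cat C X -> in_cat C (shift A X).
Proof.
move=> rt CX; exact: rt (exact_rot1 (exact_id X)) CX (in_cat0 C).
Qed.

(** The triangle runs from X[-1] through 0 to [X]; its last map is, up to sign, the isomorphism of
    [X] with X[-1][1]. *)
Lemma left_triangulated_unshift (X : A) :
  left_triangulated C -> in_cat C X -> in_cat C (unshift A X).
Proof.
move=> lt CX; have [i [/(_ X) Ii _]] := unshiftK A.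
have [j [ji ij]] := Ii; have Iid := @is_iso_id R A.
have t : exact_triangle (0 : hom (unshift A X) (zob A)) (0 : hom _ X) (- j).
  apply: (exact_iso (Iid _) (Iid (zob A)) Ii _ _ _
    (exact_rot1 (exact_id (unshift A X)))).
  - by rewrite comp0m compm0.
  - by rewrite comp0m compm0.
  - by rewrite !fhom1 comp1m compNm ji.
exact: lt t (in_cat0 C) CX.
Qed.

Lemma right_triangulated_suspensions : right_triangulated C -> has_suspensions tri_ext.
Proof.
move=> rt T; exists (exist _ _ (right_triangulated_shift rt (svalP T))).
by exists (idm (shift A (sval T))); apply/iso_suspension/is_iso_id.
Qed.

Lemma left_triangulated_suspensions : left_triangulated C -> has_suspensions (op tri_ext).
Proof.
move=> lt S; exists (exist _ _ (left_triangulated_unshift lt (svalP S))).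
have [i [/(_ (sval S)) [j [ji ij]] _]] := unshiftK A; exists j.
have [|spre spost] := @iso_suspension (exist _ _ (left_triangulated_unshift lt (svalP S))) S j.
  by exists (i (sval S)).
by split.
Qed.

(** The push-forward of the universal class of X[1] determines [f]. Hence [over_cat C] is [C] itself
    here. *)
Lemma inj_trivial_eq0 (X Y : C) (f : hom X Y) :
  right_triangulated C -> inj_trivial f -> f = 0.
Proof.
move=> /right_triangulated_suspensions/(_ X)[S [s [_ /(_ Y)/bij_inj spost]]] f0.
by apply: spost; rewrite post0m; apply: f0.
Qed.

Lemma proj_trivial_eq0 (X Y : C) (f : hom X Y) :
  left_triangulated C -> proj_trivial f -> f = 0.
Proof.
move=> /left_triangulated_suspensions/(_ Y)[T [s [_ /(_ X)/bij_inj spre]]] f0.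
by apply: spre; rewrite post0m; apply: f0.
Qed.

End TriExactExt.

(** * Auslander-Reiten and Serre functors *)

Section QuotientFunctors.
Local Open Scope ring_scope.
Variables (R : comPzRingType) (C : linCat R).

Lemma qclass_eq0 (J : ideal C) (X Y : C) (f : hom X Y) :
  in_ideal J f -> qclass J f = 0.
Proof.
rewrite -[f]subr0 => /eq_qclass; rewrite subr0 => ->.
exact: linear0 (mk_linear (@qclass_linear R C J X Y)).
Qed.

Section ZeroIdeal.
Variable J : ideal C.
Hypothesis J0 : forall (X Y : C) (f : hom X Y), in_ideal J f -> f = 0.

Lemma qclassK (X Y : C) (f : hom X Y) : qrepr (qclass J f) = f.
Proof.
by apply/eqP; rewrite -subr_eq0; apply/eqP/J0/eq_qclass; rewrite qreprK.
Qed.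

Lemma qrepr_linear (X Y : C) : linear (@qrepr R C J X Y).
Proof.
by move=> a f g; rewrite -[f]qreprK -[g]qreprK -qclass_linear !qclassK.
Qed.

Lemma qrepr_iso (X Y : C) (q : @hom R (quotient_cat J) X Y) :
  is_iso q -> is_iso (qrepr q).
Proof.
move=> [p [pq qp]]; exists (qrepr p); split.
  by have := congr1 (@qrepr R C J X X) pq; rewrite /= /qcomp !qclassK.
by have := congr1 (@qrepr R C J Y Y) qp; rewrite /= /qcomp !qclassK.
Qed.

End ZeroIdeal.

Section Induced.
Variables (J1 J2 : ideal C) (T : C -> C) (t : forall X Y : C, hom X Y -> hom (T X) (T Y)).
Hypothesis t1 : forall X, t (idm X) = idm (T X).
Hypothesis tM : forall (X Y Z : C) (g : hom Y Z) (f : hom X Y), t (g \oc f) = t g \oc t f.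
Hypothesis tJ : forall (X Y : C) (f g : hom X Y), in_ideal J1 (f - g) -> t f = t g.

Definition induced_hom (X Y : C) (q : qhom J1 X Y) : qhom J2 (T X) (T Y) :=
  qclass J2 (t (qrepr q)).

Lemma induced_homE (X Y : C) (f : hom X Y) :
  induced_hom (qclass J1 f) = qclass J2 (t f).
Proof. by congr (qclass J2 _); apply/tJ/eq_qclass; rewrite qreprK. Qed.

Fact induced_hom1 (X : C) : induced_hom (qclass J1 (idm X)) = qclass J2 (idm (T X)).
Proof. by rewrite induced_homE t1. Qed.

Fact induced_homM (X Y Z : C) (g : qhom J1 Y Z) (f : qhom J1 X Y) :
  induced_hom (qcomp g f) = qcomp (induced_hom g) (induced_hom f).
Proof.
by rewrite -[g]qreprK -[f]qreprK qclass_comp !induced_homE qclass_comp tM.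
Qed.

Definition induced_functor : functor (quotient_cat J1) (quotient_cat J2) :=
  @Functor R (quotient_cat J1) (quotient_cat J2) T induced_hom induced_hom1 induced_homM.

Lemma induced_equivalence :
  (forall (X Y : C) (f : hom X Y), in_ideal J2 f -> f = 0) ->
  (forall (X Y : C) (f g : hom X Y), t f = t g -> in_ideal J1 (f - g)) ->
  (forall (X Y : C) (g : hom (T X) (T Y)), exists f : hom X Y, t f = g) ->
  (forall Y : C, exists (X : C) (a : hom (T X) Y), is_iso a) ->
  is_equivalence induced_functor.
Proof.
move=> J0 inj full surj; apply: fully_faithful_equivalence.
- move=> X Y f g; rewrite -[f]qreprK -[g]qreprK /= !induced_homE.
  by move/eq_qclass/J0/eqP; rewrite subr_eq0 => /eqP/inj/eq_qclass.
- move=> X Y g; have [f fE] := full X Y (qrepr g).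
  by exists (qclass J1 f); rewrite /= induced_homE fE qreprK.
- move=> Y; have [X [a [b [ba ab]]]] := surj Y.
  by exists X, (qclass J2 a), (qclass J2 b); rewrite /= !qclass_comp ba ab.
Qed.

End Induced.

End QuotientFunctors.

(** * Translates and their functoriality *)

Section Translates.
Local Open Scope ring_scope.
Variables (R : comPzRingType) (I : lmodType R) (C : extCat R).
Hypotheses (cogI : cogenerator I) (hr : hom_reflexive C I) (hs : has_suspensions C).

(* In [op C] this is a choice of inverse Auslander-Reiten translates. *)
Record translate := Translate {
  tr_ob : C -> C;
  tr_form : forall X, {linear ext X (tr_ob X) -> I};
  tr_rep : forall X, represents (tr_form X);
  tr_hom : forall X Y, hom X Y -> hom (tr_ob X) (tr_ob Y);
  tr_homE : forall X Y (u : hom X Y) e, tr_form Y (tr_hom u \ac e) = tr_form X (e \pc u)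
}.

Lemma translate_exists :
  (forall Z : C, exists (T : C) (th : {linear ext Z T -> I}), represents th) ->
  exists t : translate, True.
Proof.
move=> rep; pose T X := sval (cid (rep X)); pose th X := sval (cid (svalP (cid (rep X)))).
have thP X : represents (th X) := svalP (cid (svalP (cid (rep X)))).
pose t X Y (u : hom X Y) := cid (represents_hom cogI hr hs (th X) u (thP Y)).
by exists (Translate thP (fun X Y u => svalP (t X Y u))).
Qed.

Variable t : translate.

(** Uniqueness of transposes: functoriality of [tr_hom] reduces to identities under the forms. *)
Lemma tr_hom_eq (X Y : C) (u : hom X Y) (v : hom (tr_ob t X) (tr_ob t Y)) :
  (forall e, tr_form t Y (v \ac e) = tr_form t X (e \pc u)) -> tr_hom t u = v.
Proof.
move=> vE; apply: (represents_hom_inj cogI hr hs (tr_rep t Y)) => e.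
by rewrite tr_homE vE.
Qed.

Lemma tr_hom1 (X : C) : tr_hom t (idm X) = idm (tr_ob t X).
Proof. by apply: tr_hom_eq => e; rewrite post1 pre1. Qed.

Lemma tr_homM (X Y Z : C) (g : hom Y Z) (f : hom X Y) :
  tr_hom t (g \oc f) = tr_hom t g \oc tr_hom t f.
Proof.
by apply: tr_hom_eq => e; rewrite postA tr_homE post_pre tr_homE preA.
Qed.

Lemma tr_hom_resp (X Y : C) (f g : hom X Y) :
  ext_trivial_pre (f - g) -> tr_hom t f = tr_hom t g.
Proof.
move=> fg; apply: tr_hom_eq => e; rewrite tr_homE; congr (tr_form t X _).
by apply/eqP; rewrite eq_sym -subr_eq0 -preB fg.
Qed.

Lemma tr_hom_inj (X Y : C) (f g : hom X Y) :
  tr_hom t f = tr_hom t g -> ext_trivial_pre (f - g).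
Proof.
move=> fg; apply: (tr_rep t X).1 => e.
by rewrite preB linearB /= -!tr_homE fg subrr.
Qed.

(** The form of [Y] composed with [v] is a form on [ext Y (tr_ob t X)], hence comes from some [u],
    whose transpose is [v]. *)
Lemma tr_hom_full (X Y : C) (v : hom (tr_ob t X) (tr_ob t Y)) :
  exists u : hom X Y, tr_hom t u = v.
Proof.
have [u uE] := (tr_rep t X).2 Y (tr_form t Y \o mk_linear (post_linear (M := Y) v)).
by exists u; apply: tr_hom_eq => e; rewrite -uE.
Qed.

Lemma tr_ob_iso (Z T : C) (th : {linear ext Z T -> I}) :
  represents th -> exists a : hom (tr_ob t Z) T, is_iso a.
Proof. by move=> r; apply: (represents_uniq cogI hr hs r (tr_rep t Z)). Qed.

End Translates.

Section ExtActions.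
Local Open Scope ring_scope.
Variables (R : comPzRingType) (A : triCat R) (C : triExactCat A).

Lemma over_ext_id (M X : C) (e : Ext1 M X) : over_ext (idm (X : over_cat C)) e = e.
Proof. by rewrite (over_extE (idm X)) /ext_post fhom1; apply: comp1m. Qed.

Lemma under_ext_id (X M : C) (e : Ext1 X M) : under_ext e (idm (X : under_cat C)) = e.
Proof. by rewrite (under_extE (idm X)); apply: compm1. Qed.

Lemma over_ext_linear (M X Y : C) (e : Ext1 M X) :
  linear (fun q : @hom R (over_cat C) X Y => over_ext q e).
Proof.
move=> a p q; rewrite -[p]qreprK -[q]qreprK -qclass_linear.
by rewrite !over_extE ext_post_lin.
Qed.

Lemma under_ext_linear (X Y M : C) (e : Ext1 Y M) :
  linear (fun q : @hom R (under_cat C) X Y => under_ext e q).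
Proof.
move=> a p q; rewrite -[p]qreprK -[q]qreprK -qclass_linear.
by rewrite !under_extE ext_pre_lin.
Qed.

End ExtActions.

(** * Right Auslander-Reiten and Serre functors *)

Section RightFunctors.
Local Open Scope ring_scope.
Variables (R : comPzRingType) (I : lmodType R) (A : triCat R) (C : triExactCat A).
Hypotheses (cogI : cogenerator I) (hr : hom_reflexive C I).
Hypothesis rt : right_triangulated C.
Local Notation E := (tri_ext C).
Let hs : has_suspensions E := right_triangulated_suspensions rt.

Let over0 (X Y : C) (f : hom X Y) : in_ideal (inj_trivial_ideal C) f -> f = 0.
Proof. exact: inj_trivial_eq0. Qed.

Let over_classK (X Y : C) (f : hom X Y) : qrepr (over_class f) = f.
Proof. exact: (qclassK over0). Qed.

(** As in the Yoneda lemma, the form is the image of the identity of [Z], and naturality recovers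
    [phi] from it. *)
Lemma right_AR_represents (tau : functor (under_cat C) (over_cat C)) :
  right_AR_functor I tau ->
  forall Z : C, exists th : {linear @ext R E Z (tau Z) -> I}, represents th.
Proof.
move=> [phi [phib phiN]] Z; exists (phi Z Z (under_class (idm Z))).
have phiE (Y : C) (f : hom Z Y) (e : Ext1 Y (tau Z)) :
    phi Z Y (under_class f) e = phi Z Z (under_class (idm Z)) (ext_pre e f).
  have := phiN Z Z Z Y (idm Z) f (under_class (idm Z)) e.
  by rewrite fhom1 over_ext_id !compm1.
split=> Y.
  move=> f f0.
  suff /(bij_inj (phib Z Y))/eq_qclass :
      phi Z Y (under_class f) = phi Z Y (under_class 0).
    by rewrite subr0.
  apply: dual_ext => e; rewrite (phiE _ f) (phiE _ 0) ext_pre0r linear0.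
  exact: f0.
move=> psi; have [ps _ psK] := phib Z Y.
exists (qrepr (ps psi)) => e; rewrite -phiE.
by rewrite /under_class qreprK psK.
Qed.

Section FromTranslate.
Variable t : translate I E.

Let tJ (X Y : C) (f g : hom X Y) :
  in_ideal (proj_trivial_ideal C) (f - g) -> tr_hom t f = tr_hom t g.
Proof. exact: (tr_hom_resp cogI hr hs). Qed.

Definition right_translate_functor : functor (under_cat C) (over_cat C) :=
  induced_functor (inj_trivial_ideal C)
    (fun X => tr_hom1 cogI hr hs t X) (@tr_homM _ _ _ cogI hr hs t) tJ.

Lemma right_translate_AR : right_AR_functor I right_translate_functor.
Proof.
pose ph (X Y : C) (q : @hom R (under_cat C) X Y) : dual I (Ext1 Y (tr_ob t X)) :=
  (tr_form t X \o mk_linear (@pre_linear R E X Y (tr_ob t X) (qrepr q)) :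
     Ext1 Y (tr_ob t X) -> I).
have phl X Y : linear (@ph X Y).
  move=> a p q; apply: dual_ext => e.
  exact: etrans (congr1 (tr_form t X) (under_ext_linear e a p q)) (linearP _ _ _ _).
have phE (X Y : C) (f : hom X Y) (e : Ext1 Y (tr_ob t X)) :
    (ph X Y (under_class f) : {linear _ -> _}) e = tr_form t X (ext_pre e f).
  by rewrite -under_extE.
exists (fun X Y => mk_linear (phl X Y)); split.
  move=> X Y; apply: inj_surj_bijective.
    apply: (raddf_inj (f := mk_linear (phl X Y))) => q; rewrite -[q]qreprK => q0.
    apply: qclass_eq0; apply: (tr_rep t X).1 => e; rewrite -phE.
    by have := congr1 (fun F : {linear Ext1 Y (tr_ob t X) -> I} => F e) q0.
  move=> psi; have [f fE] := (tr_rep t X).2 Y psi.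
  by exists (under_class f); apply: dual_ext => e; rewrite fE -phE.
move=> X X' Y Y' u v q e; rewrite -[q]qreprK; set f := qrepr q.
have -> : under_class v \oc qclass _ f \oc under_class u = under_class (v \oc f \oc u).
  by rewrite /under_class /= !qclass_comp.
have -> : over_ext (fhom right_translate_functor (under_class u)) e =
    ext_post (tr_hom t u) e by rewrite -over_extE /= (induced_homE _ tJ).
apply: etrans (phE _ _ _ _) _; apply: etrans _ (esym (phE _ _ _ _)).
(* Naturality in [u] is the defining identity of its transpose. *)
have := @tr_homE _ _ _ t _ _ u (ext_pre (ext_pre e v) f).
by rewrite !ext_pre_comp => <-; rewrite /= /ext_pre /ext_post !compA.
Qed.

Lemma right_translate_equivalence :
  (forall T : E, exists (Z : E) (th : {linear ext Z T -> I}), represents th) ->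
  is_equivalence right_translate_functor.
Proof.
move=> corep; apply: induced_equivalence over0 _ _ _.
- exact: tr_hom_inj.
- exact: (tr_hom_full cogI hr hs).
- by move=> T; have [Z [th /(tr_ob_iso cogI hr hs t)]] := corep T; exists Z.
Qed.

End FromTranslate.

Definition shift_ob (X : C) : C :=
  exist _ (shift A (sval X)) (right_triangulated_shift rt (svalP X)).

Definition over_shift : functor (over_cat C) (over_cat C) :=
  @induced_functor R C (inj_trivial_ideal C) (inj_trivial_ideal C)
    shift_ob (fun X Y f => fhom (shift A) f) (fun X => fhom1 (shift A) (sval X))
    (fun X Y Z g f => fhomM (shift A) g f)
    (fun X Y f g J => congr1 (@fhom _ _ _ (shift A) (sval X) (sval Y))
       (subr0_eq (over0 J))).

(** Ext into [tau X] is Hom into its shift, and passing to [over_cat] changes no morphisms. *)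
Lemma right_AR_Serre (tau : functor (under_cat C) (over_cat C)) :
  right_AR_functor I tau -> right_Serre_functor I (comp_functor over_shift tau).
Proof.
move=> [phi [phib phiN]].
have rl (X Y : C) := qrepr_linear over0 (X := X) (Y := over_shift (tau Y)).
pose ps (X Y : C) (q : @hom R (under_cat C) X Y) :
    dual I (@hom R (over_cat C) Y (over_shift (tau X))) :=
  ((phi X Y q : {linear Ext1 Y (tau X) -> I}) \o mk_linear (rl Y X) :
     @hom R (over_cat C) Y (over_shift (tau X)) -> I).
have psl X Y : linear (@ps X Y).
  by move=> a p q; apply: dual_ext => e; rewrite /ps /= linearP.
exists (fun X Y => mk_linear (psl X Y)); split.
  move=> X Y; apply: inj_surj_bijective.
    move=> p q pq; apply: (bij_inj (phib X Y)); apply: dual_ext => e.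
    have := congr1 (fun F : {linear @hom R (over_cat C) Y (over_shift (tau X)) -> I} =>
      F (@over_class R A C Y (shift_ob (tau X)) e)) pq.
    by rewrite /= over_classK.
  move=> psi; have [g _ gK] := phib X Y.
  have ol := @qclass_linear R C (inj_trivial_ideal C) Y (over_shift (tau X)).
  exists (g ((psi : {linear @hom R (over_cat C) Y (over_shift (tau X)) -> I})
    \o mk_linear ol : Ext1 Y (tau X) -> I)).
  by apply: dual_ext => e; rewrite /ps /= gK /= qreprK.
move=> X X' Y Y' u v q e.
apply: etrans (phiN _ _ _ _ _ _ _ _) _; rewrite /ps /=; congr (phi X Y q _).
by rewrite /qcomp /induced_hom !(qclassK over0).
Qed.

Lemma over_shift_equivalence : left_triangulated C -> is_equivalence over_shift.
Proof.
move=> lt; apply: induced_equivalence over0 _ _ _ => [X Y f g|X Y g|Y].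
- by move=> /shift_inj ->; rewrite subrr; apply: ideal0.
- exact: shift_full.
exists (exist _ _ (left_triangulated_unshift lt (svalP Y))).
by have [i [Ii _]] := unshiftK A; exists (i (sval Y)); apply: Ii.
Qed.

Lemma over_shift_image (X : C) : shift_subcat C 1 (sval (over_shift X)).
Proof.
have [i [Ii _]] := shiftK A; have [j [ji ij]] := Ii (sval X).
have Ij : is_iso j by exists (i (sval X)).
exact: in_cat_iso Ij (svalP X).
Qed.

(** Through [i], [Ext1 Y T] becomes [hom Y (S Z)], and the form is again the image of the identity.
    Any [T] with T[1] isomorphic to [S Z] is allowed, which also serves for Serre equivalences. *)
Lemma right_Serre_represents (S : functor (under_cat C) (over_cat C)) (Z T : C)
    (i : @hom R A (shift A (sval T)) (sval (S Z))) :
  right_Serre_functor I S -> is_iso i ->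
  exists th : {linear @ext R E Z T -> I}, represents th.
Proof.
move=> [phi [phib phiN]] [r [ri ir]].
have phiE (Y : C) (f : hom Z Y) (g : @hom R (over_cat C) Y (S Z)) :
    phi Z Y (under_class f) g = phi Z Z (under_class (idm Z)) (g \oc over_class f).
  have := phiN Z Z Z Y (idm Z) f (under_class (idm Z)) g.
  by rewrite fhom1 comp1m !compm1.
pose cl (Y : C) (e : Ext1 Y T) : @hom R (over_cat C) Y (S Z) :=
  @over_class R A C Y (S Z) (i \oc e).
have cll Y : linear (@cl Y).
  by move=> a e e'; rewrite /cl comp_linearr; apply: qclass_linear.
pose un (Y : C) (g : @hom R (over_cat C) Y (S Z)) : Ext1 Y T := r \oc qrepr g.
have unl Y : linear (@un Y).
  by move=> a g g'; rewrite /un (qrepr_linear over0) comp_linearr.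
have unK Y (g : @hom R (over_cat C) Y (S Z)) : cl Y (un Y g) = g.
  by rewrite /cl /un compA ir comp1m; apply: qreprK.
have clK Y (e : Ext1 Y T) : un Y (cl Y e) = e.
  by rewrite /cl /un over_classK compA ri comp1m.
have clM (Y Y' : C) (e : Ext1 Y T) (f : hom Y' Y) :
    cl Y e \oc over_class f = cl Y' (ext_pre e f).
  by rewrite /over_class /= qclass_comp /cl /ext_pre compA.
exists (phi Z Z (under_class (idm Z)) \o mk_linear (cll Z)); split=> Y.
  move=> f f0.
  suff /(bij_inj (phib Z Y))/eq_qclass :
      phi Z Y (under_class f) = phi Z Y (under_class 0) by rewrite subr0.
  apply: dual_ext => g; rewrite (phiE _ f) (phiE _ 0) -[g]unK !clM ext_pre0r.
  have -> : cl Z 0 = 0 := linear0 (mk_linear (cll Z)).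
  rewrite linear0; exact: f0.
move=> psi; have [ps _ psK] := phib Z Y.
pose q := ps (psi \o mk_linear (unl Y) : @hom R (over_cat C) Y (S Z) -> I).
exists (qrepr q) => e.
rewrite /= -[ext_pre _ _]/(ext_pre e (qrepr q)) -clM -phiE /under_class qreprK psK /=.
by rewrite clK.
Qed.

End RightFunctors.

(** * Left Auslander-Reiten and Serre functors, through the opposite Ext structure *)

Section LeftFunctors.
Local Open Scope ring_scope.
Variables (R : comPzRingType) (I : lmodType R) (A : triCat R) (C : triExactCat A).
Hypotheses (cogI : cogenerator I) (hr : hom_reflexive C I).
Hypothesis lt : left_triangulated C.
Local Notation E := (op (tri_ext C)).
Let hs : has_suspensions E := left_triangulated_suspensions lt.
Let hrop : hom_reflexive E I := fun X Y => hr Y X.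

Let under0 (X Y : C) (f : hom X Y) : in_ideal (proj_trivial_ideal C) f -> f = 0.
Proof. exact: proj_trivial_eq0. Qed.

Let under_classK (X Y : C) (f : hom X Y) : qrepr (under_class f) = f.
Proof. exact: (qclassK under0). Qed.

Lemma left_AR_represents (tau : functor (over_cat C) (under_cat C)) :
  left_AR_functor I tau ->
  forall Z : C, exists th : {linear @ext R E Z (tau Z) -> I}, represents th.
Proof.
move=> [phi [phib phiN]] Z; exists (phi Z Z (over_class (idm Z))).
have phiE (Y : C) (f : hom Y Z) (e : Ext1 (tau Z) Y) :
    phi Y Z (over_class f) e = phi Z Z (over_class (idm Z)) (ext_post f e).
  have := phiN Z Y Z Z f (idm Z) (over_class (idm Z)) e.
  by rewrite fhom1 under_ext_id !comp1m.
split=> Y.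
  move=> f f0.
  suff /(bij_inj (phib Y Z))/eq_qclass :
      phi Y Z (over_class f) = phi Y Z (over_class 0) by rewrite subr0.
  apply: dual_ext => e; rewrite (phiE _ f) (phiE _ 0) ext_post0l linear0.
  exact: f0.
move=> psi; have [ps _ psK] := phib Y Z.
exists (qrepr (ps psi)) => e; apply: etrans (phiE _ _ _).
by rewrite /over_class qreprK psK.
Qed.

Section FromTranslate.
Variable t : translate I E.

Let tJ (X Y : C) (f g : hom X Y) :
  in_ideal (inj_trivial_ideal C) (f - g) ->
  @tr_hom _ _ _ t Y X f = @tr_hom _ _ _ t Y X g.
Proof. exact: (@tr_hom_resp _ _ _ cogI hrop hs t). Qed.

Definition left_translate_functor : functor (over_cat C) (under_cat C) :=
  @induced_functor R C (inj_trivial_ideal C) (proj_trivial_ideal C)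
    (tr_ob t) (fun X Y f => @tr_hom _ _ _ t Y X f)
    (fun X => tr_hom1 cogI hrop hs t X)
    (fun X Y Z g f => @tr_homM _ _ _ cogI hrop hs t Z Y X f g) tJ.

Lemma left_translate_AR : left_AR_functor I left_translate_functor.
Proof.
pose ph (X Y : C) (q : @hom R (over_cat C) X Y) : dual I (Ext1 (tr_ob t Y) X) :=
  (tr_form t Y \o mk_linear (@post_linear R (tri_ext C) (tr_ob t Y) X Y (qrepr q)) :
     Ext1 (tr_ob t Y) X -> I).
have phl X Y : linear (@ph X Y).
  move=> a p q; apply: dual_ext => e.
  exact: etrans (congr1 (tr_form t Y) (over_ext_linear e a p q)) (linearP _ _ _ _).
have phE (X Y : C) (f : hom X Y) (e : Ext1 (tr_ob t Y) X) :
    (ph X Y (over_class f) : {linear _ -> _}) e = tr_form t Y (ext_post f e).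
  by rewrite -over_extE.
exists (fun X Y => mk_linear (phl X Y)); split.
  move=> X Y; apply: inj_surj_bijective.
    apply: (raddf_inj (f := mk_linear (phl X Y))) => q; rewrite -[q]qreprK => q0.
    apply: qclass_eq0; apply: (tr_rep t Y).1 => e.
    apply: etrans (esym (phE _ _ _ _)) _.
    by have := congr1 (fun F : {linear Ext1 (tr_ob t Y) X -> I} => F e) q0.
  move=> psi; have [f fE] := (tr_rep t Y).2 X psi.
  by exists (over_class f); apply: dual_ext => e; rewrite fE; apply: phE.
move=> X X' Y Y' u v q e; rewrite -[q]qreprK; set f := qrepr q.
have -> : over_class v \oc qclass _ f \oc over_class u = over_class (v \oc f \oc u).
  by rewrite /over_class /= !qclass_comp.
have -> : under_ext e (fhom left_translate_functor (over_class v)) =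
    ext_pre e (@tr_hom _ _ _ t Y' Y v) by rewrite -under_extE /= (induced_homE _ tJ).
apply: etrans (phE _ _ _ _) _; apply: etrans _ (esym (phE _ _ _ _)).
have := @tr_homE _ _ _ t _ _ v (ext_post f (ext_post u e)) => /esym H.
rewrite -compA !ext_post_comp; apply: etrans H _.
by rewrite /= /ext_pre /ext_post !compA.
Qed.

End FromTranslate.

Definition unshift_ob (X : C) : C :=
  exist _ (unshift A (sval X)) (left_triangulated_unshift lt (svalP X)).

Definition under_unshift : functor (under_cat C) (under_cat C) :=
  @induced_functor R C (proj_trivial_ideal C) (proj_trivial_ideal C)
    unshift_ob (fun X Y f => fhom (unshift A) f) (fun X => fhom1 (unshift A) (sval X))
    (fun X Y Z g f => fhomM (unshift A) g f)
    (fun X Y f g J => congr1 (@fhom _ _ _ (unshift A) (sval X) (sval Y))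
       (subr0_eq (under0 J))).

(** Shifting and composing with [j] identifies Hom from (tau Y)[-1] with Ext from [tau Y]. *)
Lemma left_AR_Serre (tau : functor (over_cat C) (under_cat C)) :
  left_AR_functor I tau -> left_Serre_functor I (comp_functor under_unshift tau).
Proof.
move=> [phi [phib phiN]].
have [i [Ii iN]] := unshiftK A.
have /(_ _)/cid jP := Ii; pose j X := sval (jP X).
have ji X : j X \oc i X = idm _ := (svalP (jP X)).1.
have ij X : i X \oc j X = idm _ := (svalP (jP X)).2.
have jN (X Y : A) (f : hom X Y) :
    fhom (shift A) (fhom (unshift A) f) \oc j X = j Y \oc f.
  apply: (iso_cancell (Ii Y)); rewrite (compA (i Y) (j Y)) ij comp1m compA.
  by have /= <- := iN _ _ f; rewrite -compA ij compm1.
pose un (X Y : C) (g : @hom R (under_cat C) (unshift_ob Y) X) : Ext1 Y X :=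
  fhom (shift A) (qrepr g) \oc j (sval Y).
have unl (X Y : C) : linear (@un X Y).
  by move=> a g h; rewrite /un (qrepr_linear under0) shift_linear comp_linearl.
have unb (X Y : C) : bijective (@un X Y).
  apply: inj_surj_bijective => [g h gh|e].
    apply: (can_inj (@qreprK _ _ _ _ _)); apply: shift_inj.
    have Ij : is_iso (j (sval Y)) by exists (i (sval Y)).
    exact: (iso_cancelr Ij gh).
  have [g gE] := shift_full (e \oc i (sval Y)).
  exists (@under_class R A C (unshift_ob Y) X g).
  by rewrite /un under_classK gE -compA ij compm1.
pose ps (X Y : C) (q : @hom R (over_cat C) X Y) :
    dual I (@hom R (under_cat C) (unshift_ob (tau Y)) X) :=
  ((phi X Y q : {linear Ext1 (tau Y) X -> I}) \o mk_linear (unl X (tau Y)) :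
     @hom R (under_cat C) (unshift_ob (tau Y)) X -> I).
have psl X Y : linear (@ps X Y).
  by move=> a p q; apply: dual_ext => e; rewrite /ps /= linearP.
exists (fun X Y => mk_linear (psl X Y)); split.
  move=> X Y; have [nu unK nuK] := unb X (tau Y); apply: inj_surj_bijective.
    move=> p q pq; apply: (bij_inj (phib X Y)); apply: dual_ext => e.
    have := congr1
      (fun F : {linear @hom R (under_cat C) (unshift_ob (tau Y)) X -> I} => F (nu e)) pq.
    by rewrite /= nuK.
  move=> psi; have [g _ gK] := phib X Y.
  have nul : linear nu.
    by move=> a e e'; apply: (can_inj unK); rewrite unl !nuK.
  exists (g ((psi : {linear @hom R (under_cat C) (unshift_ob (tau Y)) X -> I})
    \o mk_linear nul : Ext1 (tau Y) X -> I)).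
  by apply: dual_ext => e; rewrite /ps /= gK /= unK.
move=> X X' Y Y' u v q g.
apply: etrans (phiN _ _ _ _ _ _ _ _) _; rewrite /ps /=; congr (phi X Y q _).
rewrite /un /qcomp /induced_hom !(qclassK under0) !fhomM -compA jN.
by rewrite /ext_post /under_ext /ext_pre !compA.
Qed.

Lemma under_unshift_image (X : C) : shift_subcat C (-1) (sval (under_unshift X)).
Proof.
have [i [Ii _]] := unshiftK A; have [j [ji ij]] := Ii (sval X).
have Ij : is_iso j by exists (i (sval X)).
exact: in_cat_iso Ij (svalP X).
Qed.

(** Here [T] is a shift of [S Z], so [un] turns morphisms out of [S Z] into classes in [Ext1 T Y];
    [nu] is its inverse. *)
Lemma left_Serre_represents (S : functor (over_cat C) (under_cat C)) (Z T : C)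
    (i : @hom R A (shift A (sval (S Z))) (sval T)) :
  left_Serre_functor I S -> is_iso i ->
  exists th : {linear @ext R E Z T -> I}, represents th.
Proof.
move=> [phi [phib phiN]] Ii.
have phiE (Y : C) (f : hom Y Z) (g : @hom R (under_cat C) (S Z) Y) :
    phi Y Z (over_class f) g = phi Z Z (over_class (idm Z)) (under_class f \oc g).
  have := phiN Z Y Z Z f (idm Z) (over_class (idm Z)) g.
  by rewrite fhom1 compm1 !comp1m.
pose un (Y : C) (g : @hom R (under_cat C) (S Z) Y) : Ext1 T Y :=
  fhom (shift A) (qrepr g) \oc sval (cid Ii).
have [ri ir] := svalP (cid Ii).
have unl Y : linear (@un Y).
  by move=> a g h; rewrite /un (qrepr_linear under0) shift_linear comp_linearl.
have unb Y : bijective (@un Y).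
  apply: inj_surj_bijective => [g h gh|e].
    apply: (can_inj (@qreprK _ _ _ _ _)); apply: shift_inj.
    have Ir : is_iso (sval (cid Ii)) by exists i.
    exact: (iso_cancelr Ir gh).
  have [g gE] := shift_full (e \oc i).
  exists (@under_class R A C (S Z) Y g).
  by rewrite /un under_classK gE -compA ir compm1.
have unM (Y Y' : C) (g : @hom R (under_cat C) (S Z) Y) (f : hom Y Y') :
    ext_post f (un Y g) = un Y' (under_class f \oc g).
  by rewrite /un /= /qcomp !(qclassK under0) fhomM /ext_post compA.
have nuP Y (e : Ext1 T Y) : {g | un Y g = e}.
  by apply: cid; have [nu _ nuK] := unb Y; exists (nu e).
pose nu Y e := sval (nuP Y e).
have nuK Y e : un Y (nu Y e) = e := svalP (nuP Y e).
have nul Y : linear (@nu Y).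
  by move=> a e e'; apply: (bij_inj (unb Y)); rewrite unl !nuK.
have unK Y g : nu Y (un Y g) = g by apply: (bij_inj (unb Y)); rewrite nuK.
have nuM (Y Y' : C) (e : Ext1 T Y) (f : hom Y Y') :
    nu Y' (ext_post f e) = under_class f \oc nu Y e.
  by rewrite -{1}[e]nuK unM unK.
exists (phi Z Z (over_class (idm Z)) \o mk_linear (nul Z)); split=> Y.
  move=> f f0.
  suff /(bij_inj (phib Y Z))/eq_qclass :
      phi Y Z (over_class f) = phi Y Z (over_class 0) by rewrite subr0.
  apply: dual_ext => g; rewrite (phiE _ f) (phiE _ 0) -[g]unK -!nuM ext_post0l.
  have -> : nu Z 0 = 0 := linear0 (mk_linear (nul Z)).
  rewrite linear0; exact: f0.
move=> psi; have [ps _ psK] := phib Y Z.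
pose q := ps (psi \o mk_linear (unl Y) : @hom R (under_cat C) (S Z) Y -> I).
exists (qrepr q) => e.
rewrite /= -[ext_post _ _]/(ext_post (qrepr q) e) nuM -phiE /over_class qreprK psK /=.
by rewrite nuK.
Qed.

End LeftFunctors.

Definition representable (R : comPzRingType) (I : lmodType R) (C : extCat R) : Prop :=
  forall Z : C, exists (T : C) (th : {linear ext Z T -> I}), represents th.

Definition corepresentable (R : comPzRingType) (I : lmodType R) (C : extCat R) : Prop :=
  forall T : C, exists (Z : C) (th : {linear ext Z T -> I}), represents th.

(** By [represents_op] the pairing is perfect in the other variable too, so the same form serves in
    the opposite category. *)
Lemma represents_dual (R : comPzRingType) (I : lmodType R) (C : extCat R) :
  cogenerator I -> hom_reflexive C I -> has_suspensions C ->
  forall (Z T : C) (th : {linear ext Z T -> I}),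
    represents th -> @represents R I (op C) T Z th.
Proof.
move=> cogI hr hs Z T th /(represents_op cogI hr hs)[thi ths]; split=> // Y f f0 M e.
by have -> : f = 0%R; [apply: thi | apply: (@prem0 R (op C))].
Qed.

(** * All conditions expressed through representability *)

Section Criteria.
Variables (R : comPzRingType) (I : lmodType R) (A : triCat R) (C : triExactCat A).
Hypotheses (cogI : cogenerator I) (hr : hom_reflexive C I) (hKS : krull_schmidt C).
Local Notation E := (tri_ext C).
Let hrop : hom_reflexive (op E) I := fun X Y => hr Y X.

Lemma almost_split_right_representable : right_triangulated C ->
  has_almost_split_sequences_right C <-> representable I E.
Proof.
move=> rt; rewrite -has_almost_split_rightE.
exact: almost_split_rightP cogI hr (right_triangulated_suspensions rt) hKS.
Qed.

Lemma almost_split_left_representable : left_triangulated C ->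
  has_almost_split_sequences_left C <-> representable I (op E).
Proof.
move=> lt; rewrite -has_almost_split_leftE.
exact: almost_split_rightP cogI hrop (left_triangulated_suspensions lt)
  (op_krull_schmidt hKS).
Qed.

Lemma right_AR_representable : right_triangulated C ->
  (exists tau : functor (under_cat C) (over_cat C), right_AR_functor I tau) <->
  representable I E.
Proof.
move=> rt; have hs := right_triangulated_suspensions rt.
split=> [[tau AR] Z|/(translate_exists cogI hr hs)].
  by exists (tau Z); apply: right_AR_represents.
by case=> t _; exists (right_translate_functor cogI hr rt t); apply: right_translate_AR.
Qed.

Lemma left_AR_representable : left_triangulated C ->
  (exists tau : functor (over_cat C) (under_cat C), left_AR_functor I tau) <->
  representable I (op E).
Proof.
move=> lt; have hs := left_triangulated_suspensions lt.
split=> [[tau AR] Z|/(translate_exists cogI hrop hs)].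
  by exists (tau Z); apply: left_AR_represents.
by case=> t _; exists (left_translate_functor cogI hr lt t); apply: left_translate_AR.
Qed.

Lemma right_Serre_representable : right_triangulated C ->
  (exists S : functor (under_cat C) (over_cat C),
     right_Serre_functor I S /\ forall X : C, shift_subcat C 1 (sval (S X))) <->
  representable I E.
Proof.
move=> rt; split=> [[S [SS SC]] Z|/(right_AR_representable rt)[tau AR]].
  have [i [Ii _]] := unshiftK A.
  (* The hypothesis on the image says precisely that this inverse shift of [S Z] lies in [C]. *)
  pose T : C := exist _ (unshift A (sval (S Z))) (SC Z); exists T.
  exact: (right_Serre_represents rt (T := T) SS (Ii (sval (S Z)))).
exists (comp_functor (over_shift rt) tau); split; first exact: right_AR_Serre.
by move=> X; apply: over_shift_image.
Qed.

Lemma left_Serre_representable : left_triangulated C ->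
  (exists S : functor (over_cat C) (under_cat C),
     left_Serre_functor I S /\ forall X : C, shift_subcat C (-1) (sval (S X))) <->
  representable I (op E).
Proof.
move=> lt; split=> [[S [SS SC]] Z|/(left_AR_representable lt)[tau AR]].
  pose T : C := exist _ (shift A (sval (S Z))) (SC Z); exists T.
  exact: (left_Serre_represents lt (T := T) SS (is_iso_id _)).
exists (comp_functor (under_unshift lt) tau); split; first exact: left_AR_Serre.
by move=> X; apply: under_unshift_image.
Qed.

Section Triangulated.
Hypotheses (lt : left_triangulated C) (rt : right_triangulated C).
Let hs := right_triangulated_suspensions rt.
Let hsop := left_triangulated_suspensions lt.

Lemma representable_opE : representable I (op E) <-> corepresentable I E.
Proof.
split=> rep Z; have [T [th thP]] := rep Z; exists T, th.
  exact: (represents_dual cogI hrop hsop thP).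
exact: (represents_dual cogI hr hs thP).
Qed.

Lemma over_qrepr_iso (X Y : C) (a : @hom R (over_cat C) X Y) :
  is_iso a -> is_iso (qrepr a).
Proof. by apply: qrepr_iso => U V f; apply: inj_trivial_eq0. Qed.

Lemma under_qrepr_iso (X Y : C) (a : @hom R (under_cat C) X Y) :
  is_iso a -> is_iso (qrepr a).
Proof. by apply: qrepr_iso => U V f; apply: proj_trivial_eq0. Qed.

(** Density of [tau] corresponds to corepresentability: every [T] is isomorphic to some [tau Z], and
    a representing form moves along the isomorphism. *)
Lemma right_AR_equivalence_birepresentable :
  (exists tau : functor (under_cat C) (over_cat C),
     right_AR_functor I tau /\ is_equivalence tau) <->
  representable I E /\ corepresentable I E.
Proof.
split=> [[tau [AR /is_equivalence_surj eq]]|[/(translate_exists cogI hr hs)[t _] corep]].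
  split=> T; first by exists (tau T); apply: right_AR_represents.
  have [Z [a /over_qrepr_iso Ia]] := eq T; have [th thP] := right_AR_represents AR Z.
  by exists Z; apply: (represents_iso Ia thP).
exists (right_translate_functor cogI hr rt t).
by split; [apply: right_translate_AR | apply: right_translate_equivalence].
Qed.

(** One implication suffices: conversely, the right equivalence already gives one side of the
    disjunction. *)
Lemma left_AR_equivalence_birepresentable :
  (exists tau : functor (over_cat C) (under_cat C),
     left_AR_functor I tau /\ is_equivalence tau) ->
  representable I E /\ corepresentable I E.
Proof.
move=> [tau [AR /is_equivalence_surj eq]]; split; last first.
  by apply/representable_opE => T; exists (tau T); apply: left_AR_represents.
move=> Z; have [T [a /under_qrepr_iso Ia]] := eq Z.
have [th thP] := left_AR_represents AR T; exists T.
have [b [ba ab]] := Ia; have Ib : @is_iso R (op E) (tau T) Z b by exists (qrepr a).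
have [th' thP'] := represents_iso Ib thP.
by exists th'; apply: (represents_dual cogI hrop hsop thP').
Qed.

Lemma right_Serre_equivalence_birepresentable :
  (exists S : functor (under_cat C) (over_cat C),
     right_Serre_functor I S /\ is_equivalence S) <->
  representable I E /\ corepresentable I E.
Proof.
split=> [[S [SS /is_equivalence_surj eq]]|/right_AR_equivalence_birepresentable].
  split=> T.
    have [i [Ii _]] := unshiftK A.
    exists (unshift_ob lt (S T : C)).
    exact: (right_Serre_represents rt (T := unshift_ob lt (S T : C)) SS (Ii (sval (S T)))).
  (* Density is applied to T[1], since [S Z] must be its shift. *)
  have [Z [a /over_qrepr_iso[b [ba ab]]]] := eq (shift_ob rt T); exists Z.
  have Ib : is_iso (b : @hom R A (shift A (sval T)) (sval (S Z))) by exists (qrepr a).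
  exact: (right_Serre_represents rt SS Ib).
move=> [tau [AR eq]]; exists (comp_functor (over_shift rt) tau).
split; first exact: right_AR_Serre.
by apply: comp_equivalence => //; apply: over_shift_equivalence.
Qed.

Lemma left_Serre_equivalence_birepresentable :
  (exists S : functor (over_cat C) (under_cat C),
     left_Serre_functor I S /\ is_equivalence S) ->
  representable I E /\ corepresentable I E.
Proof.
move=> [S [SS /is_equivalence_surj eq]]; split; last first.
  apply/representable_opE => T; exists (shift_ob rt (S T : C)).
  exact: (left_Serre_represents lt (T := shift_ob rt (S T : C)) SS (is_iso_id _)).
move=> Z; have [i [Ii _]] := unshiftK A.
have [T [a /under_qrepr_iso Ia]] := eq (unshift_ob lt Z).
pose a' : @hom R A (sval (S T)) (unshift A (sval Z)) := qrepr a.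
have Ib : is_iso (i (sval Z) \oc fhom (shift A) a').
  by apply: is_iso_comp; [apply: Ii | apply: fhom_iso].
have [th thP] := left_Serre_represents lt SS Ib.
by exists T, th; apply: (represents_dual cogI hrop hsop thP).
Qed.

End Triangulated.

End Criteria.

Theorem theorem4p10 (R : comPzRingType) (I : lmodType R)
    (hI : minimal_injective_cogenerator I)
    (A : triCat R) (C : triExactCat A)
    (hrefl : hom_reflexive C I) (hKS : krull_schmidt C) :
  [/\ right_triangulated C ->
        (has_almost_split_sequences_right C <->
           exists tau : functor (under_cat C) (over_cat C), right_AR_functor I tau) /\
        ((exists tau : functor (under_cat C) (over_cat C), right_AR_functor I tau) <->
         exists S : functor (under_cat C) (over_cat C),
           right_Serre_functor I S /\ forall X : C, shift_subcat C 1 (sval (S X))),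
      left_triangulated C ->
        (has_almost_split_sequences_left C <->
           exists tau : functor (over_cat C) (under_cat C), left_AR_functor I tau) /\
        ((exists tau : functor (over_cat C) (under_cat C), left_AR_functor I tau) <->
         exists S : functor (over_cat C) (under_cat C),
           left_Serre_functor I S /\ forall X : C, shift_subcat C (-1) (sval (S X))) &
      triangulated C ->
        (has_almost_split_sequences C <->
           (exists tau : functor (under_cat C) (over_cat C),
              right_AR_functor I tau /\ is_equivalence tau) \/
           (exists tau : functor (over_cat C) (under_cat C),
              left_AR_functor I tau /\ is_equivalence tau)) /\
        ((exists tau : functor (under_cat C) (over_cat C),
              right_AR_functor I tau /\ is_equivalence tau) \/
         (exists tau : functor (over_cat C) (under_cat C),
              left_AR_functor I tau /\ is_equivalence tau) <->
         (exists S : functor (under_cat C) (over_cat C),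
              right_Serre_functor I S /\ is_equivalence S) \/
         (exists S : functor (over_cat C) (under_cat C),
              left_Serre_functor I S /\ is_equivalence S))].
Proof.
have [_ cogI _] := hI; split=> [rt|lt|[lt rt]].
(* In the one-sided cases every condition is equivalent to representability, in [tri_ext C] or in
   its opposite. *)
- rewrite (almost_split_right_representable cogI hrefl hKS rt).
  by rewrite (right_AR_representable cogI hrefl rt) (right_Serre_representable cogI hrefl rt).
- rewrite (almost_split_left_representable cogI hrefl hKS lt).
  by rewrite (left_AR_representable cogI hrefl lt) (left_Serre_representable cogI hrefl lt).
(* In the triangulated case the common condition is representability together with
   corepresentability. *)
have AR := right_AR_equivalence_birepresentable cogI hrefl rt.
have Se := right_Serre_equivalence_birepresentable cogI hrefl lt rt.
have ARl := left_AR_equivalence_birepresentable cogI hrefl lt rt.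
have Sel := left_Serre_equivalence_birepresentable cogI hrefl lt rt.
rewrite /has_almost_split_sequences (almost_split_right_representable cogI hrefl hKS rt).
rewrite (almost_split_left_representable cogI hrefl hKS lt).
rewrite (representable_opE cogI hrefl lt rt).
tauto.
Qed.
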